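(* Let $R$ be a commutative ring with identity. For each $1\le n\le\infty$ there is a faithful representation $$e\colon \mathcal{H}_n^R\longrightarrow L_n^R,$$ i.e. an injective group homomorphism from $\mathcal{H}_n^R$ into the group of units of the algebra $L_n^R$.
   Context: The Cohen group $K^R_n=K^R_n(x_1,\dots,x_n)$ is the quotient of the free product $\coprod_{i=1}^n R_{x_i}$, where $R_{x}$ is a copy of the additive group of $R$ labelled by $x$ and $x^r$ denotes the element $r\in R_x=R$, by the relations (for all $l$, all indices in $\{1,\dots,n\}$ and all $r_s,r_s'\in R$): (1) $[[x_{i_1}^{r_1},x_{i_2}^{r_2}],\dots,x_{i_l}^{r_l}]=1$ if $i_s=i_t$ for some $1\le s<t\le l$; (2) $[[x_{i_1}^{r_1},x_{i_2}^{r_2}],\dots,x_{i_l}^{r_l}]=[[x_{i_1}^{r_1'},x_{i_2}^{r_2'}],\dots,x_{i_l}^{r_l'}]$ if $r_1r_2\cdots r_l=r_1'r_2'\cdots r_l'$. Here $[x,y]=x^{-1}y^{-1}xy$ and the iterated commutators are bracketed from the left. For $1\le j\le n$ let $p_j\colon K_n^R\to K_{n-1}^R$ be the homomorphism with $p_j(x_i^r)=x_i^r$ for $i<j$, $p_j(x_j^r)=1$, $p_j(x_i^r)=x_{i-1}^r$ for $i>j$. For finite $n$, $\mathcal{H}^R_n$ is the equalizer of $p_1,\dots,p_n$; the common restriction of the $p_j$ is $d_n\colon\mathcal{H}^R_n\to\mathcal{H}^R_{n-1}$, and $\mathcal{H}^R_\infty=\lim_{d_n}\mathcal{H}^R_n$.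 $A^R(y_1,\dots,y_n)$ is the quotient of the tensor algebra $T(y_1,\dots,y_n)$ over $R$ by the two-sided ideal generated by the monomials $y_{i_1}\cdots y_{i_t}$ with $i_p=i_q$ for some $1\le p<q\le t$. For finite $n$, $L^R_n\subseteq A^R(y_1,\dots,y_n)$ is the equalizer of the algebra homomorphisms $\pi_j\colon A^R(y_1,\dots,y_n)\to A^R(y_1,\dots,y_{n-1})$, $1\le j\le n$, with $\pi_j(y_k)=y_k$ for $k<j$, $\pi_j(y_j)=0$, $\pi_j(y_k)=y_{k-1}$ for $k>j$; the common restriction of the $\pi_j$ is $d_n\colon L^R_n\to L^R_{n-1}$, and $L^R_\infty=\lim_{d_n}L^R_n$. *)

(* Defs.v *)
From HB Require Import structures.
From mathcomp Require Import all_boot all_algebra.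
From mathcomp Require Import zify boolp functions.

Set Implicit Arguments.
Unset Strict Implicit.
Unset Printing Implicit Defensive.

Import GRing.Theory.
Local Open Scope ring_scope.
Local Open Scope quotient_scope.

Lemma group_morph1 (G H : groupType) (f : G -> H) :
  {morph f : x y / (x * y)%g} -> f 1%g = 1%g.
Proof. by move=> fM; apply: (@mulgI _ (f 1%g)); rewrite -fM !mulg1. Qed.

Section FreeProduct.
Variables (I : choiceType) (V : zmodType).
Local Notation word := (seq (I * V)).

(* The word [:: (i1, a1); ..; (ik, ak)] stands for the product of the elements
   a1 of the i1-th copy of V, .., ak of the ik-th copy of V. *)
Inductive word_eq : word -> word -> Prop :=
| word_eq_refl u : word_eq u u
| word_eq_sym u v : word_eq u v -> word_eq v u
| word_eq_trans v u w : word_eq u v -> word_eq v w -> word_eq u w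
| word_eq_cat u u' v v' :
    word_eq u u' -> word_eq v v' -> word_eq (u ++ v) (u' ++ v')
| word_eq_add i a b : word_eq [:: (i, a); (i, b)] [:: (i, a + b)]
| word_eq_zero i : word_eq [:: (i, 0)] [::].

Definition word_eqb u v := `[< word_eq u v >].

Lemma word_eqb_refl : reflexive word_eqb.
Proof. by move=> u; apply/asboolP/word_eq_refl. Qed.

Lemma word_eqb_sym : symmetric word_eqb.
Proof. by move=> u v; apply: asbool_equiv_eq; split=> /word_eq_sym. Qed.

Lemma word_eqb_trans : transitive word_eqb.
Proof.
by move=> v u w /asboolP uv /asboolP vw; apply/asboolP/(word_eq_trans uv vw).
Qed.

Definition word_equiv :=
  EquivRel word_eqb word_eqb_refl word_eqb_sym word_eqb_trans.

Definition free_product : Type := {eq_quot word_equiv}.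
HB.instance Definition _ := EqQuotient.on free_product.
HB.instance Definition _ := Choice.on free_product.

Definition fp_of_word (u : word) : free_product := \pi u.

Lemma fp_of_wordP u v : fp_of_word u = fp_of_word v <-> word_eq u v.
Proof.
by split=> [/eqmodP/asboolP //|uv]; apply/eqmodP; apply/asboolP.
Qed.

Lemma fp_reprP u : word_eq (repr (fp_of_word u)) u.
Proof. by apply/fp_of_wordP; rewrite /fp_of_word reprK. Qed.

Lemma fp_of_wordK x : fp_of_word (repr x) = x.
Proof. exact: reprK. Qed.

Definition word_inv (u : word) : word := rev [seq (p.1, - p.2) | p <- u].

Lemma word_inv_cat u v : word_inv (u ++ v) = word_inv v ++ word_inv u.
Proof. by rewrite /word_inv map_cat rev_cat. Qed.

Lemma word_invK : involutive word_inv.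
Proof.
move=> u; rewrite /word_inv map_rev revK -map_comp -[RHS]map_id.
by apply: eq_map => -[i a] /=; rewrite opprK.
Qed.

Lemma word_eq_inv u v : word_eq u v -> word_eq (word_inv u) (word_inv v).
Proof.
elim=> {u v} [u|u v _|v u w _ uv _ vw|u u' v v' _ uu _ vv|i a b|i].
- exact: word_eq_refl.
- exact: word_eq_sym.
- exact: word_eq_trans uv vw.
- by rewrite !word_inv_cat; exact: word_eq_cat.
- by rewrite /word_inv /= opprD addrC; exact: word_eq_add.
- by rewrite /word_inv /= oppr0; exact: word_eq_zero.
Qed.

Lemma word_eqVw u : word_eq (word_inv u ++ u) [::].
Proof.
elim: u => [|[i a] u IHu]; first exact: word_eq_refl.
have aV : word_eq (word_inv [:: (i, a)] ++ [:: (i, a)]) [::].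
  apply: word_eq_trans (word_eq_zero i).
  by rewrite /word_inv /= -(addNr a); exact: word_eq_add.
rewrite -cat1s word_inv_cat -catA (catA (word_inv [:: (i, a)])).
apply: word_eq_trans IHu; apply: word_eq_cat (word_eq_refl _) _.
exact: word_eq_cat aV (word_eq_refl u).
Qed.

Definition fp_one : free_product := fp_of_word [::].
Definition fp_mul (x y : free_product) := fp_of_word (repr x ++ repr y).
Definition fp_inv (x : free_product) := fp_of_word (word_inv (repr x)).

Lemma fp_mulE u v : fp_mul (fp_of_word u) (fp_of_word v) = fp_of_word (u ++ v).
Proof. by apply/fp_of_wordP/word_eq_cat; exact: fp_reprP. Qed.

Lemma fp_invE u : fp_inv (fp_of_word u) = fp_of_word (word_inv u).
Proof. by apply/fp_of_wordP/word_eq_inv/fp_reprP. Qed.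

Lemma fp_mulA : associative fp_mul.
Proof.
move=> x y z; rewrite -[x]fp_of_wordK -[y]fp_of_wordK -[z]fp_of_wordK.
by rewrite !fp_mulE catA.
Qed.

Lemma fp_mul1 : left_id fp_one fp_mul.
Proof. by move=> x; rewrite -[x]fp_of_wordK fp_mulE. Qed.

Lemma fp_mulr1 : right_id fp_one fp_mul.
Proof. by move=> x; rewrite -[x]fp_of_wordK fp_mulE cats0. Qed.

Lemma fp_mulV : left_inverse fp_one fp_inv fp_mul.
Proof.
move=> x; rewrite -[x]fp_of_wordK fp_invE fp_mulE.
by apply/fp_of_wordP/word_eqVw.
Qed.

Lemma fp_mulVr : right_inverse fp_one fp_inv fp_mul.
Proof.
move=> x; rewrite -[x]fp_of_wordK fp_invE fp_mulE.
by apply/fp_of_wordP; rewrite -{1}[repr x]word_invK; exact: word_eqVw.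
Qed.

HB.instance Definition _ := isGroup.Build free_product
  fp_mulA fp_mul1 fp_mulr1 fp_mulV fp_mulVr.

Definition fp_gen (i : I) (a : V) : free_product := fp_of_word [:: (i, a)].

Lemma fp_of_wordM u v :
  fp_of_word (u ++ v) = (fp_of_word u * fp_of_word v)%g.
Proof. by rewrite -fp_mulE. Qed.

Lemma fp_of_wordE u : fp_of_word u = (\prod_(p <- u) fp_gen p.1 p.2)%g.
Proof.
elim: u => [|[i a] u IHu]; first by rewrite big_nil.
by rewrite big_cons -IHu -fp_of_wordM.
Qed.

Lemma fp_genD i a b : fp_gen i (a + b) = (fp_gen i a * fp_gen i b)%g.
Proof. by rewrite -fp_of_wordM; apply/fp_of_wordP/word_eq_sym/word_eq_add. Qed.

Section Lift.
Variables (G : groupType) (f : I -> V -> G).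

Definition fp_lift of (forall i a b, f i (a + b) = (f i a * f i b)%g) :=
  fun x : free_product => (\prod_(p <- repr x) f p.1 p.2)%g.

Hypothesis fD : forall i a b, f i (a + b) = (f i a * f i b)%g.

Lemma word_eq_lift u v : word_eq u v ->
  (\prod_(p <- u) f p.1 p.2)%g = (\prod_(p <- v) f p.1 p.2)%g.
Proof.
elim=> {u v} [//|//|v u w _ -> _ -> //|u u' v v' _ uu _ vv|i a b|i].
- by rewrite !big_cat /= uu vv.
- by rewrite !big_cons big_nil /= !mulg1 fD.
- rewrite big_seq1 big_nil /=; apply: (@mulgI _ (f i 0)).
  by rewrite -fD addr0 mulg1.
Qed.

Lemma fp_lift_word u :
  fp_lift fD (fp_of_word u) = (\prod_(p <- u) f p.1 p.2)%g.
Proof. exact/word_eq_lift/fp_reprP. Qed.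

Lemma fp_lift_gen i a : fp_lift fD (fp_gen i a) = f i a.
Proof. by rewrite fp_lift_word big_seq1. Qed.

Lemma fp_liftM : {morph fp_lift fD : x y / (x * y)%g}.
Proof.
move=> x y; rewrite -[x]fp_of_wordK -[y]fp_of_wordK -fp_of_wordM.
by rewrite !fp_lift_word big_cat.
Qed.

HB.instance Definition _ :=
  isUMagmaMorphism.Build free_product G (fp_lift fD)
    (group_morph1 fp_liftM, fp_liftM).
End Lift.

End FreeProduct.

Section QuotientGroup.
Variables (G : groupType) (S : G -> Prop).

Inductive normal_closure : G -> Prop :=
| normal_closure_gen x : S x -> normal_closure x
| normal_closure1 : normal_closure 1%g
| normal_closureM x y :
    normal_closure x -> normal_closure y -> normal_closure (x * y)%g
| normal_closureV x : normal_closure x -> normal_closure x^-1%g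
| normal_closureJ x y : normal_closure x -> normal_closure (x ^ y)%g.

Definition nc_eqb x y := `[< normal_closure (x / y)%g >].

Lemma nc_eqb_refl : reflexive nc_eqb.
Proof. by move=> x; apply/asboolP; rewrite mulgV; exact: normal_closure1. Qed.

Lemma nc_eqb_sym : symmetric nc_eqb.
Proof.
move=> x y; apply: asbool_equiv_eq.
by split=> /normal_closureV; rewrite invgM invgK.
Qed.

Lemma nc_eqb_trans : transitive nc_eqb.
Proof.
move=> y x z /asboolP xy /asboolP yz; apply/asboolP.
by have := normal_closureM xy yz; rewrite mulgA mulgVK.
Qed.

Definition nc_equiv := EquivRel nc_eqb nc_eqb_refl nc_eqb_sym nc_eqb_trans.

Definition quotient_group : Type := {eq_quot nc_equiv}.
HB.instance Definition _ := EqQuotient.on quotient_group.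
HB.instance Definition _ := Choice.on quotient_group.

Definition qg_pi (x : G) : quotient_group := \pi x.

Lemma qg_piP x y : qg_pi x = qg_pi y <-> normal_closure (x / y)%g.
Proof.
by split=> [/eqmodP/asboolP //|xy]; apply/eqmodP; apply/asboolP.
Qed.

Lemma qg_reprP x : normal_closure (repr (qg_pi x) / x)%g.
Proof. by apply/qg_piP; rewrite /qg_pi reprK. Qed.

Lemma qg_reprK x : qg_pi (repr x) = x.
Proof. exact: reprK. Qed.

Definition qg_mul (x y : quotient_group) := qg_pi (repr x * repr y)%g.
Definition qg_inv (x : quotient_group) := qg_pi (repr x)^-1%g.

Lemma qg_mulE x y : qg_mul (qg_pi x) (qg_pi y) = qg_pi (x * y)%g.
Proof.
apply/qg_piP; have := normal_closureM (qg_reprP x)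
  (normal_closureJ x^-1 (qg_reprP y)).
by rewrite !conjgE invgK invgM !mulgA mulgVK.
Qed.

Lemma qg_invE x : qg_inv (qg_pi x) = qg_pi x^-1%g.
Proof.
apply/qg_piP; have := normal_closureJ x (normal_closureV (qg_reprP x)).
by rewrite !conjgE invgM !invgK !mulgA mulVg mul1g.
Qed.

Lemma qg_mulA : associative qg_mul.
Proof.
move=> x y z; rewrite -[x]qg_reprK -[y]qg_reprK -[z]qg_reprK.
by rewrite !qg_mulE mulgA.
Qed.

Lemma qg_mul1 : left_id (qg_pi 1%g) qg_mul.
Proof. by move=> x; rewrite -[x]qg_reprK qg_mulE mul1g. Qed.

Lemma qg_mulr1 : right_id (qg_pi 1%g) qg_mul.
Proof. by move=> x; rewrite -[x]qg_reprK qg_mulE mulg1. Qed.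

Lemma qg_mulV : left_inverse (qg_pi 1%g) qg_inv qg_mul.
Proof. by move=> x; rewrite -[x]qg_reprK qg_invE qg_mulE mulVg. Qed.

Lemma qg_mulVr : right_inverse (qg_pi 1%g) qg_inv qg_mul.
Proof. by move=> x; rewrite -[x]qg_reprK qg_invE qg_mulE mulgV. Qed.

HB.instance Definition _ := isGroup.Build quotient_group
  qg_mulA qg_mul1 qg_mulr1 qg_mulV qg_mulVr.

Lemma qg_piM : {morph qg_pi : x y / (x * y)%g}.
Proof. by move=> x y; rewrite -qg_mulE. Qed.

HB.instance Definition _ := isUMagmaMorphism.Build G quotient_group qg_pi
  (group_morph1 qg_piM, qg_piM).

Section Lift.
Variables (H : groupType) (f : UMagmaMorphism.type G H).

Definition qg_lift of (forall x, S x -> f x = 1%g) :=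
  fun x : quotient_group => f (repr x).

Hypothesis fS : forall x, S x -> f x = 1%g.

Lemma normal_closure_lift x : normal_closure x -> f x = 1%g.
Proof.
elim=> {x} [x /fS //||x y _ fx _ fy|x _ fx|x y _ fx].
- exact: gmulf1.
- by rewrite gmulfM fx fy mulg1.
- by rewrite gmulfV fx invg1.
- by rewrite gmulfJ fx conj1g.
Qed.

Lemma qg_lift_pi x : qg_lift fS (qg_pi x) = f x.
Proof.
apply: divg1_eq; rewrite -gmulfF.
by apply: normal_closure_lift; exact: qg_reprP.
Qed.

Lemma qg_liftM : {morph qg_lift fS : x y / (x * y)%g}.
Proof.
move=> x y; rewrite -[x]qg_reprK -[y]qg_reprK -qg_piM.
by rewrite !qg_lift_pi gmulfM.
Qed.

HB.instance Definition _ :=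
  isUMagmaMorphism.Build quotient_group H (qg_lift fS)
    (group_morph1 qg_liftM, qg_liftM).
End Lift.

End QuotientGroup.

Section QuotientRing.
Variables (A : pzRingType) (S : A -> Prop).

Inductive ideal_closure : A -> Prop :=
| ideal_closure_gen x : S x -> ideal_closure x
| ideal_closure0 : ideal_closure 0
| ideal_closureD x y :
    ideal_closure x -> ideal_closure y -> ideal_closure (x + y)
| ideal_closureMl a x : ideal_closure x -> ideal_closure (a * x)
| ideal_closureMr a x : ideal_closure x -> ideal_closure (x * a).

Lemma ideal_closureN x : ideal_closure x -> ideal_closure (- x).
Proof. by rewrite -mulN1r; exact: ideal_closureMl. Qed.

Definition ideal_eqb x y := `[< ideal_closure (x - y) >].

Lemma ideal_eqb_refl : reflexive ideal_eqb.
Proof. by move=> x; apply/asboolP; rewrite subrr; exact: ideal_closure0. Qed.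

Lemma ideal_eqb_sym : symmetric ideal_eqb.
Proof.
move=> x y; apply: asbool_equiv_eq.
by split=> /ideal_closureN; rewrite opprB.
Qed.

Lemma ideal_eqb_trans : transitive ideal_eqb.
Proof.
move=> y x z /asboolP xy /asboolP yz; apply/asboolP.
by have := ideal_closureD xy yz; rewrite addrA subrK.
Qed.

Definition ideal_equiv :=
  EquivRel ideal_eqb ideal_eqb_refl ideal_eqb_sym ideal_eqb_trans.

Definition quotient_ring : Type := {eq_quot ideal_equiv}.
HB.instance Definition _ := EqQuotient.on quotient_ring.
HB.instance Definition _ := Choice.on quotient_ring.

Definition qr_pi (x : A) : quotient_ring := \pi x.

Lemma qr_piP x y : qr_pi x = qr_pi y <-> ideal_closure (x - y).
Proof.
by split=> [/eqmodP/asboolP //|xy]; apply/eqmodP; apply/asboolP.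
Qed.

Lemma qr_reprP x : ideal_closure (repr (qr_pi x) - x).
Proof. by apply/qr_piP; rewrite /qr_pi reprK. Qed.

Lemma qr_reprK x : qr_pi (repr x) = x.
Proof. exact: reprK. Qed.

Definition qr_add (x y : quotient_ring) := qr_pi (repr x + repr y).
Definition qr_opp (x : quotient_ring) := qr_pi (- repr x).
Definition qr_mul (x y : quotient_ring) := qr_pi (repr x * repr y).

Lemma qr_addE x y : qr_add (qr_pi x) (qr_pi y) = qr_pi (x + y).
Proof.
apply/qr_piP; have := ideal_closureD (qr_reprP x) (qr_reprP y).
by rewrite addrACA opprD.
Qed.

Lemma qr_oppE x : qr_opp (qr_pi x) = qr_pi (- x).
Proof. by apply/qr_piP; rewrite -opprD; apply/ideal_closureN/qr_reprP. Qed.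

Lemma qr_mulE x y : qr_mul (qr_pi x) (qr_pi y) = qr_pi (x * y).
Proof.
apply/qr_piP; have := ideal_closureD
  (ideal_closureMr (repr (qr_pi y)) (qr_reprP x))
  (ideal_closureMl x (qr_reprP y)).
by rewrite mulrBl mulrBr addrA subrK.
Qed.

Lemma qr_addA : associative qr_add.
Proof.
move=> x y z; rewrite -[x]qr_reprK -[y]qr_reprK -[z]qr_reprK.
by rewrite !qr_addE addrA.
Qed.

Lemma qr_addC : commutative qr_add.
Proof.
by move=> x y; rewrite -[x]qr_reprK -[y]qr_reprK !qr_addE addrC.
Qed.

Lemma qr_add0 : left_id (qr_pi 0) qr_add.
Proof. by move=> x; rewrite -[x]qr_reprK qr_addE add0r. Qed.

Lemma qr_addN : left_inverse (qr_pi 0) qr_opp qr_add.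
Proof. by move=> x; rewrite -[x]qr_reprK qr_oppE qr_addE addNr. Qed.

Lemma qr_mulA : associative qr_mul.
Proof.
move=> x y z; rewrite -[x]qr_reprK -[y]qr_reprK -[z]qr_reprK.
by rewrite !qr_mulE mulrA.
Qed.

Lemma qr_mul1 : left_id (qr_pi 1) qr_mul.
Proof. by move=> x; rewrite -[x]qr_reprK qr_mulE mul1r. Qed.

Lemma qr_mulr1 : right_id (qr_pi 1) qr_mul.
Proof. by move=> x; rewrite -[x]qr_reprK qr_mulE mulr1. Qed.

Lemma qr_mulDl : left_distributive qr_mul qr_add.
Proof.
move=> x y z; rewrite -[x]qr_reprK -[y]qr_reprK -[z]qr_reprK.
by rewrite !(qr_mulE, qr_addE) mulrDl.
Qed.

Lemma qr_mulDr : right_distributive qr_mul qr_add.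
Proof.
move=> x y z; rewrite -[x]qr_reprK -[y]qr_reprK -[z]qr_reprK.
by rewrite !(qr_mulE, qr_addE) mulrDr.
Qed.

HB.instance Definition _ := GRing.isPzRing.Build quotient_ring
  qr_addA qr_addC qr_add0 qr_addN qr_mulA qr_mul1 qr_mulr1 qr_mulDl qr_mulDr.

Lemma qr_piD : {morph qr_pi : x y / x + y}.
Proof. by move=> x y; rewrite -qr_addE. Qed.

Lemma qr_piM : {morph qr_pi : x y / x * y}.
Proof. by move=> x y; rewrite -qr_mulE. Qed.

HB.instance Definition _ := GRing.isNmodMorphism.Build A quotient_ring qr_pi
  (conj (erefl : qr_pi 0 = 0) qr_piD).
HB.instance Definition _ := GRing.isMonoidMorphism.Build A quotient_ring qr_pi
  (erefl : qr_pi 1 = 1, qr_piM).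
Section Lift.
Variables (B : pzRingType) (f : {rmorphism A -> B}).

Definition qr_lift of (forall x, S x -> f x = 0) :=
  fun x : quotient_ring => f (repr x).

Hypothesis fS : forall x, S x -> f x = 0.

Lemma ideal_closure_lift x : ideal_closure x -> f x = 0.
Proof.
elim=> {x} [x /fS //||x y _ fx _ fy|a x _ fx|a x _ fx].
- exact: rmorph0.
- by rewrite rmorphD fx fy addr0.
- by rewrite rmorphM fx mulr0.
- by rewrite rmorphM fx mul0r.
Qed.

Lemma qr_lift_pi x : qr_lift fS (qr_pi x) = f x.
Proof.
apply/eqP; rewrite -subr_eq0 -rmorphB; apply/eqP.
by apply: ideal_closure_lift; exact: qr_reprP.
Qed.

Lemma qr_lift0 : qr_lift fS 0 = 0.
Proof. by rewrite qr_lift_pi rmorph0. Qed.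

Lemma qr_lift1 : qr_lift fS 1 = 1.
Proof. by rewrite qr_lift_pi rmorph1. Qed.

Lemma qr_liftD : {morph qr_lift fS : x y / x + y}.
Proof.
move=> x y; rewrite -[x]qr_reprK -[y]qr_reprK -qr_piD.
by rewrite !qr_lift_pi rmorphD.
Qed.

Lemma qr_liftM : {morph qr_lift fS : x y / x * y}.
Proof.
move=> x y; rewrite -[x]qr_reprK -[y]qr_reprK -qr_piM.
by rewrite !qr_lift_pi rmorphM.
Qed.

HB.instance Definition _ := GRing.isNmodMorphism.Build quotient_ring B
  (qr_lift fS) (conj qr_lift0 qr_liftD).
HB.instance Definition _ := GRing.isMonoidMorphism.Build quotient_ring B
  (qr_lift fS) (qr_lift1, qr_liftM).
End Lift.

End QuotientRing.

Section EliminateIndices.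
Variable n : nat.

(* Removing first j and then i, for two suitable orders, removes the same
   pair of indices. *)
Lemma lift_swap (i i' : 'I_n) : exists j j' : 'I_n.+1,
  forall k, lift j (lift i k) = lift j' (lift i' k).
Proof.
wlog: i i' / (i <= i')%N => [wlogH|].
  have [/wlogH //|/ltnW/wlogH [j [j' jj']]] := leqP i i'.
  by exists j', j => k; rewrite jj'.
rewrite leq_eqVlt => /orP[/eqP/val_inj <-|lt_ii'].
  by exists ord0, ord0.
exists (lift ord0 i'), (widen_ord (leqnSn n) i) => k.
apply: val_inj; rewrite /= /bump /=.
by case: (leqP i k); case: (leqP i' k); case: (leqP i.+1 k) => /=;
  rewrite ?addn0 ?add0n ?add1n; lia.
Qed.

Lemma unlift_swap (i i' : 'I_n) : exists j j' : 'I_n.+1,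
  forall k, obind (unlift i) (unlift j k) = obind (unlift i') (unlift j' k).
Proof.
have [j [j' jj']] := lift_swap i i'; exists j, j' => k.
have im (a : 'I_n) (b : 'I_n.+1) c :
    obind (unlift a) (unlift b k) = Some c <-> k = lift b (lift a c).
  split=> [|->]; last by rewrite liftK /= liftK.
  by case: unliftP => //= l ->; case: unliftP => //= m -> [->].
case E: (obind _ _) => [c|]; first by move/im: E; rewrite jj' => /im.
case E': (obind _ _) => [c|//]; by move/im: E'; rewrite -jj' => /im; rewrite E.
Qed.

End EliminateIndices.

Section CohenGroup.
Variable R : comPzRingType.

(* [[..[g1, g2], ..], gl] *)
Definition iter_commg (G : groupType) (s : seq G) : G :=
  if s is x :: s' then foldl commg x s' else 1%g.

Lemma iter_commg_morph (G H : groupType) (f : UMagmaMorphism.type G H)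
  (s : seq G) : f (iter_commg s) = iter_commg (map f s).
Proof.
case: s => [|x s] /=; first exact: gmulf1.
by elim: s x => //= y s IHs x; rewrite IHs gmulfR.
Qed.

Lemma iter_commg1 (G : groupType) (s : seq G) : 1%g \in s -> iter_commg s = 1%g.
Proof.
have foldl1 t : foldl commg (1 : G)%g t = 1%g.
  by elim: t => //= y t; rewrite comm1g.
case: s => //= x s; rewrite inE => /orP[/eqP <-|]; first exact: foldl1.
elim: s x => //= y s IHs x; rewrite inE => /orP[/eqP <-|/IHs //].
by rewrite commg1.
Qed.

Section Presentation.
Variable n : nat.

Definition free_word (s : seq ('I_n * R)) : seq (free_product 'I_n R) :=
  [seq fp_gen p.1 p.2 | p <- s].

(* A sequence [:: (i1, r1); ..; (il, rl)] is the list of the x_{i1}^{r1}, ..,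
   x_{il}^{rl} entering an iterated commutator. *)
Inductive cohen_relator : free_product 'I_n R -> Prop :=
| cohen_relator_rep s : ~~ uniq (unzip1 s) ->
    cohen_relator (iter_commg (free_word s))
| cohen_relator_prod s t : unzip1 s = unzip1 t ->
    \prod_(p <- s) p.2 = \prod_(p <- t) p.2 ->
    cohen_relator (iter_commg (free_word s) / iter_commg (free_word t))%g.

Definition cohen_group : Type := quotient_group cohen_relator.
HB.instance Definition _ := Group.on cohen_group.

Definition cohen_gen (i : 'I_n) (r : R) : cohen_group :=
  qg_pi cohen_relator (fp_gen i r).

Lemma cohen_genD i r s :
  cohen_gen i (r + s) = (cohen_gen i r * cohen_gen i s)%g.
Proof. by rewrite /cohen_gen fp_genD qg_piM. Qed.

Lemma cohen_iter_commg s :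
  iter_commg [seq cohen_gen p.1 p.2 | p <- s] =
  qg_pi cohen_relator (iter_commg (free_word s)).
Proof. by rewrite iter_commg_morph -map_comp. Qed.

Lemma cohen_rep s : ~~ uniq (unzip1 s) ->
  iter_commg [seq cohen_gen p.1 p.2 | p <- s] = 1%g.
Proof.
move=> s_rep; rewrite cohen_iter_commg; apply/qg_piP; rewrite divg1.
exact/normal_closure_gen/cohen_relator_rep.
Qed.

Lemma cohen_prod s t : unzip1 s = unzip1 t ->
    \prod_(p <- s) p.2 = \prod_(p <- t) p.2 ->
  iter_commg [seq cohen_gen p.1 p.2 | p <- s] =
  iter_commg [seq cohen_gen p.1 p.2 | p <- t].
Proof.
move=> st1 st2; rewrite !cohen_iter_commg; apply/qg_piP.
exact/normal_closure_gen/cohen_relator_prod.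
Qed.

Lemma cohen_group_ext (G : groupType) (f g : UMagmaMorphism.type cohen_group G) :
  (forall i r, f (cohen_gen i r) = g (cohen_gen i r)) -> f =1 g.
Proof.
move=> fg x; rewrite -[x]qg_reprK -[repr x]fp_of_wordK.
elim: (repr (repr x)) => [|[i r] s IHs]; first by rewrite !gmulf1.
by rewrite -cat1s fp_of_wordM qg_piM !gmulfM IHs fg.
Qed.

End Presentation.

Section Projection.
Variables (n : nat) (j : 'I_n).

(* [unlift j i] is None if i = j, and otherwise Some of the index i or i - 1
   of 'I_n.-1, according to whether i < j or i > j. *)
Definition cohen_proj_gen (i : 'I_n) (r : R) : cohen_group n.-1 :=
  if unlift j i is Some k then cohen_gen k r else 1%g.

Lemma cohen_proj_genD i r s :
  cohen_proj_gen i (r + s) = (cohen_proj_gen i r * cohen_proj_gen i s)%g.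
Proof.
rewrite /cohen_proj_gen; case: unlift => [k|]; last by rewrite mulg1.
exact: cohen_genD.
Qed.

Definition cohen_proj_free := fp_lift cohen_proj_genD.
HB.instance Definition _ := UMagmaMorphism.on cohen_proj_free.

Let drop_j (s : seq ('I_n * R)) : seq ('I_n.-1 * R) :=
  pmap (fun p => omap (fun k => (k, p.2)) (unlift j p.1)) s.

Lemma cohen_proj_free_commg s :
  cohen_proj_free (iter_commg (free_word s)) =
  if j \in unzip1 s then 1%g
  else iter_commg [seq cohen_gen p.1 p.2 | p <- drop_j s].
Proof.
rewrite iter_commg_morph -map_comp.
rewrite (eq_map (g := fun p => cohen_proj_gen p.1 p.2)); last first.
  by move=> p /=; rewrite /cohen_proj_free fp_lift_gen.
case: ifPn => j_s.
  apply: iter_commg1; case/mapP: j_s => p p_s jE.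
  by apply/mapP; exists p => //=; rewrite /cohen_proj_gen -jE unlift_none.
congr iter_commg; elim: s j_s => //= p s IHs; rewrite inE.
move=> /norP[jp js]; rewrite IHs // /cohen_proj_gen.
by case: unliftP jp => [k _|->] //=; rewrite eqxx.
Qed.

Lemma drop_j1 s : j \notin unzip1 s -> [seq lift j k | k <- unzip1 (drop_j s)] = unzip1 s.
Proof.
elim: s => //= p s IHs; rewrite inE => /norP[jp js].
case: unliftP jp => [k E _|->] /=; last by rewrite eqxx.
by rewrite IHs // -E.
Qed.

Lemma drop_j2 s : j \notin unzip1 s ->
  \prod_(p <- drop_j s) p.2 = \prod_(p <- s) p.2.
Proof.
elim: s => [|p s IHs] /=; first by rewrite !big_nil.
rewrite inE => /norP[jp js]; rewrite big_cons -IHs //.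
by case: unliftP jp => [k _ _|->] /=; rewrite ?eqxx // big_cons.
Qed.

Lemma cohen_proj_relator x : cohen_relator x -> cohen_proj_free x = 1%g.
Proof.
case=> {x} [s s_rep|s t st1 st2].
  rewrite cohen_proj_free_commg; case: ifPn => // js.
  apply: cohen_rep; apply: contra s_rep => s'_uniq.
  by rewrite -(drop_j1 js) map_inj_uniq //; exact: lift_inj.
rewrite (_ : cohen_proj_free _ = cohen_proj_free (iter_commg (free_word s))
    / cohen_proj_free (iter_commg (free_word t)))%g; last exact: gmulfF.
rewrite !cohen_proj_free_commg -st1; case: ifPn => js.
  by rewrite divg1.
rewrite (@cohen_prod _ (drop_j s) (drop_j t)) ?mulgV //.
  by apply: (inj_map (@lift_inj _ j)); rewrite !drop_j1 // -st1.
by rewrite !drop_j2 // -st1.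
Qed.

Definition cohen_proj : cohen_group n -> cohen_group n.-1 :=
  qg_lift cohen_proj_relator.
HB.instance Definition _ := UMagmaMorphism.on cohen_proj.

Lemma cohen_projE i r : cohen_proj (cohen_gen i r) = cohen_proj_gen i r.
Proof. exact: etrans (qg_lift_pi _ _) (fp_lift_gen _ _ _). Qed.

End Projection.

Lemma cohen_proj_swap n (i i' : 'I_n) : exists j j' : 'I_n.+1,
  forall x, cohen_proj i (cohen_proj j x) = cohen_proj i' (cohen_proj j' x).
Proof.
have [j [j' jj']] := unlift_swap i i'; exists j, j' => x.
pose f := cohen_proj i \o cohen_proj j.
pose f' := cohen_proj i' \o cohen_proj j'.
apply: (@cohen_group_ext n.+1 _ f f') => {x} k r.
have E (a : 'I_n) (b : 'I_n.+1) :
    cohen_proj a (cohen_proj b (cohen_gen k r)) =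
    if obind (unlift a) (unlift b k) is Some l then cohen_gen l r else 1%g.
  rewrite cohen_projE /cohen_proj_gen; case: unlift => [l|] /=.
    exact: cohen_projE.
  exact: gmulf1.
by rewrite /f /f' /= !E jj'.
Qed.

Section Equalizer.
Variable n : nat.

Definition in_cohen_H : pred (cohen_group n) :=
  fun x => `[< forall i j : 'I_n, cohen_proj i x = cohen_proj j x >].

Record cohen_H := CohenH {
  cohen_H_val :> cohen_group n;
  _ : in_cohen_H cohen_H_val
}.
HB.instance Definition _ := [isSub for cohen_H_val].
HB.instance Definition _ := [Choice of cohen_H by <:].

Lemma cohen_H_closed : group_closed in_cohen_H.
Proof.
split=> [|x y /asboolP xE /asboolP yE]; apply/asboolP => i j.
  by rewrite !gmulf1.
by rewrite !gmulfF /= (xE i j) (yE i j).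
Qed.
HB.instance Definition _ :=
  SubChoice_isSubGroup.Build _ in_cohen_H cohen_H cohen_H_closed.

End Equalizer.

Section Restriction.
Variable n : nat.

Lemma cohen_proj_hopf (x : cohen_H n.+1) :
  in_cohen_H (cohen_proj ord0 (val x)).
Proof.
have /asboolP xE := valP x; apply/asboolP => i i'.
have [j [j' jj']] := cohen_proj_swap i i'.
by rewrite {1}(xE ord0 j) jj' (xE ord0 j').
Qed.

Definition cohen_d (x : cohen_H n.+1) : cohen_H n :=
  CohenH (cohen_proj_hopf x).

Lemma cohen_dE (j : 'I_n.+1) x : val (cohen_d x) = cohen_proj j (val x).
Proof. by have /asboolP xE := valP x; exact: xE. Qed.

Lemma cohen_dM : {morph cohen_d : x y / (x * y)%g}.
Proof. by move=> x y; apply: val_inj; rewrite /= gmulfM. Qed.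

HB.instance Definition _ := isUMagmaMorphism.Build _ _ cohen_d
  (group_morph1 cohen_dM, cohen_dM).

End Restriction.

(* The inverse limit is taken over all n >= 0; as the component at 0 is the
   image of the one at 1, this is the limit over n >= 1. *)
Record cohen_H_lim := CohenHLim {
  cohen_H_lim_val :> forall n, cohen_H n;
  _ : `[< forall n, cohen_d (cohen_H_lim_val n.+1) = cohen_H_lim_val n >]
}.
HB.instance Definition _ := [isSub for cohen_H_lim_val].
HB.instance Definition _ := [Choice of cohen_H_lim by <:].

Section LimitGroup.
Implicit Types x y z : cohen_H_lim.

Lemma cohen_H_limP x n : cohen_d (x n.+1) = x n.
Proof. by case: x => x /= /asboolP. Qed.

Lemma cohen_H_lim_ext x y : (forall n, x n = y n) -> x = y.
Proof. by move=> xy; apply: val_inj; apply: functional_extensionality_dep. Qed.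

Let one_proof :
  `[< forall n, cohen_d (1%g : cohen_H n.+1) = 1%g :> cohen_H n >].
Proof. by apply/asboolP => n; rewrite gmulf1. Qed.

Let mul_proof x y :
  `[< forall n, cohen_d (x n.+1 * y n.+1)%g = (x n * y n)%g >].
Proof. by apply/asboolP => n; rewrite gmulfM /= !cohen_H_limP. Qed.

Let inv_proof x : `[< forall n, cohen_d (x n.+1)^-1%g = (x n)^-1%g >].
Proof. by apply/asboolP => n; rewrite gmulfV /= cohen_H_limP. Qed.

Definition cohen_lim_one := @CohenHLim (fun n => 1%g) one_proof.
Definition cohen_lim_mul x y :=
  @CohenHLim (fun n => (x n * y n)%g) (mul_proof x y).
Definition cohen_lim_inv x := @CohenHLim (fun n => (x n)^-1%g) (inv_proof x).

Lemma cohen_lim_mulA : associative cohen_lim_mul.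
Proof. by move=> x y z; apply: cohen_H_lim_ext => n /=; rewrite mulgA. Qed.

Lemma cohen_lim_mul1 : left_id cohen_lim_one cohen_lim_mul.
Proof. by move=> x; apply: cohen_H_lim_ext => n /=; rewrite mul1g. Qed.

Lemma cohen_lim_mulr1 : right_id cohen_lim_one cohen_lim_mul.
Proof. by move=> x; apply: cohen_H_lim_ext => n /=; rewrite mulg1. Qed.

Lemma cohen_lim_mulV : left_inverse cohen_lim_one cohen_lim_inv cohen_lim_mul.
Proof. by move=> x; apply: cohen_H_lim_ext => n /=; rewrite mulVg. Qed.

Lemma cohen_lim_mulVr : right_inverse cohen_lim_one cohen_lim_inv cohen_lim_mul.
Proof. by move=> x; apply: cohen_H_lim_ext => n /=; rewrite mulgV. Qed.

HB.instance Definition _ := isGroup.Build cohen_H_lim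
  cohen_lim_mulA cohen_lim_mul1 cohen_lim_mulr1 cohen_lim_mulV cohen_lim_mulVr.

End LimitGroup.

End CohenGroup.

Section TensorAlgebra.
Variables (R : comPzRingType) (I : choiceType).
Implicit Types (u v w : seq I) (a : R).

Definition finite_support : pred (seq I -> R) :=
  fun f => `[< exists s : seq (seq I), forall w, f w != 0 -> w \in s >].

(* The free module on I has the words in I as a basis of its tensor algebra: an
   element is the finitely supported family of its coefficients. *)
Record tensor_alg := TensorAlg {
  tcoef :> seq I -> R;
  _ : finite_support tcoef
}.
HB.instance Definition _ := [isSub for tcoef].
HB.instance Definition _ := [Choice of tensor_alg by <:].
Implicit Types x y z : tensor_alg.

Lemma tcoef_ext x y : (forall w, x w = y w) -> x = y.
Proof. by move=> xy; apply: val_inj; apply: functional_extensionality_dep. Qed.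

Lemma tcoefP x : exists s : seq (seq I), forall w, x w != 0 -> w \in s.
Proof. by case: x => x /= /asboolP. Qed.

Lemma finite_support_zmod : zmod_closed finite_support.
Proof.
split=> [|f g /asboolP[s fs] /asboolP[t gt]]; apply/asboolP.
  by exists [::] => w; rewrite eqxx.
exists (s ++ t) => w; apply: contraR; rewrite mem_cat negb_or => /andP[ws wt].
have -> : (f - g) w = f w - g w by [].
by rewrite (contraNeq (fs w) ws) (contraNeq (gt w) wt) subr0.
Qed.
HB.instance Definition _ :=
  GRing.SubChoice_isSubZmodule.Build _ finite_support tensor_alg
    finite_support_zmod.

Lemma tcoef0 w : (0 : tensor_alg) w = 0. Proof. by []. Qed.
Lemma tcoefD x y w : (x + y) w = x w + y w. Proof. by []. Qed.
Lemma tcoefN x w : (- x) w = - x w. Proof. by []. Qed.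

Lemma finite_support_scale a x : finite_support (fun w => a * x w).
Proof.
have [s xs] := tcoefP x; apply/asboolP; exists s => w aw; apply: xs.
by apply: contraNneq aw => ->; rewrite mulr0.
Qed.
Definition tscale a x := TensorAlg (finite_support_scale a x).

Lemma tscaleA a b x : tscale a (tscale b x) = tscale (a * b) x.
Proof. by apply: tcoef_ext => w /=; rewrite mulrA. Qed.

Lemma tscale1 : left_id 1 tscale.
Proof. by move=> x; apply: tcoef_ext => w /=; rewrite mul1r. Qed.

Lemma tscaleDr : right_distributive tscale +%R.
Proof. by move=> a x y; apply: tcoef_ext => w /=; rewrite mulrDr. Qed.

Lemma tscaleDl x : {morph tscale^~ x : a b / a + b}.
Proof. by move=> a b; apply: tcoef_ext => w /=; rewrite mulrDl. Qed.

HB.instance Definition _ := GRing.Zmodule_isLmodule.Build R tensor_alg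
  tscaleA tscale1 tscaleDr tscaleDl.

Lemma tcoefZ a x w : (a *: x) w = a * x w. Proof. by []. Qed.

(* The sum ranges over the factorizations of w as a concatenation. *)
Definition conv (f g : seq I -> R) w : R :=
  \sum_(i < (size w).+1) f (take i w) * g (drop i w).

Lemma conv_nil f g : conv f g [::] = f [::] * g [::].
Proof. by rewrite /conv big_ord1. Qed.

Lemma conv_cons f g c w :
  conv f g (c :: w) = f [::] * g (c :: w) + conv (f \o cons c) g w.
Proof. by rewrite /conv big_ord_recl. Qed.

Lemma convDl f g h w : conv (f + g) h w = conv f h w + conv g h w.
Proof. by rewrite -big_split; apply: eq_bigr => i _; exact: mulrDl. Qed.

Lemma convDr f g h w : conv f (g + h) w = conv f g w + conv f h w.
Proof. by rewrite -big_split; apply: eq_bigr => i _; exact: mulrDr. Qed.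

Lemma convZl a f g w : conv (fun u => a * f u) g w = a * conv f g w.
Proof. by rewrite big_distrr; apply: eq_bigr => i _ /=; rewrite mulrA. Qed.

Lemma convZr a f g w : conv f (fun u => a * g u) w = a * conv f g w.
Proof.
by rewrite big_distrr; apply: eq_bigr => i _ /=; rewrite mulrCA.
Qed.

Lemma eq_convl f f' g w : f =1 f' -> conv f g w = conv f' g w.
Proof. by move=> ff; apply: eq_bigr => i _; rewrite ff. Qed.

Lemma convA f g h w : conv f (conv g h) w = conv (conv f g) h w.
Proof.
elim: w f g => [|c w IHw] f g; first by rewrite !conv_nil mulrA.
rewrite !conv_cons conv_nil mulrDr mulrA -addrA; congr (_ + _).
rewrite IHw -convZl -convDl; apply: eq_convl => u.
by rewrite /= conv_cons.
Qed.

Definition conv_one w : R := (w == [::])%:R.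

Lemma conv1 f w : conv conv_one f w = f w.
Proof.
case: w => [|c w]; first by rewrite conv_nil /conv_one mul1r.
rewrite conv_cons /conv_one mul1r /conv big1 ?addr0 // => i _.
by rewrite /= mul0r.
Qed.

Lemma convr1 f w : conv f conv_one w = f w.
Proof.
elim: w f => [|c w IHw] f; first by rewrite conv_nil /conv_one mulr1.
by rewrite conv_cons IHw /conv_one mulr0 add0r.
Qed.

Lemma finite_support_one : finite_support conv_one.
Proof.
apply/asboolP; exists [:: [::]] => w; rewrite /conv_one inE.
by apply: contraR => /negbTE ->; exact: eqxx.
Qed.

Lemma finite_support_conv x y : finite_support (conv x y).
Proof.
have [s xs] := tcoefP x; have [t yt] := tcoefP y.
apply/asboolP; exists [seq u ++ v | u <- s, v <- t] => w.
apply: contraR => wst; rewrite /conv big1 // => i _.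
have [/eqP xi|/xs xi] := boolP (x (take i w) == 0); first by rewrite xi mul0r.
have [/eqP yi|/yt yi] := boolP (y (drop i w) == 0); first by rewrite yi mulr0.
by case/negP: wst; apply/allpairsP; exists (take i w, drop i w);
  rewrite cat_take_drop.
Qed.

Definition tone := TensorAlg finite_support_one.
Definition tmul x y := TensorAlg (finite_support_conv x y).

Lemma tmulA : associative tmul.
Proof. by move=> x y z; apply: tcoef_ext => w; exact: convA. Qed.

Lemma tmul1 : left_id tone tmul.
Proof. by move=> x; apply: tcoef_ext => w; exact: conv1. Qed.

Lemma tmulr1 : right_id tone tmul.
Proof. by move=> x; apply: tcoef_ext => w; exact: convr1. Qed.

Lemma tmulDl : left_distributive tmul +%R.
Proof. by move=> x y z; apply: tcoef_ext => w; exact: convDl. Qed.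

Lemma tmulDr : right_distributive tmul +%R.
Proof. by move=> x y z; apply: tcoef_ext => w; exact: convDr. Qed.

HB.instance Definition _ := GRing.Zmodule_isPzRing.Build tensor_alg
  tmulA tmul1 tmulr1 tmulDl tmulDr.

Lemma tcoef1 w : (1 : tensor_alg) w = (w == [::])%:R. Proof. by []. Qed.
Lemma tcoefM x y w : (x * y) w = conv x y w. Proof. by []. Qed.

Lemma tensor_scalerAl a x y : a *: (x * y) = (a *: x) * y.
Proof. by apply: tcoef_ext => w; rewrite tcoefZ !tcoefM -convZl. Qed.

Lemma tensor_scalerAr a x y : a *: (x * y) = x * (a *: y).
Proof. by apply: tcoef_ext => w; rewrite tcoefZ !tcoefM -convZr. Qed.

Lemma finite_support_gen (i : I) :
  finite_support (fun w => (w == [:: i])%:R).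
Proof.
apply/asboolP; exists [:: [:: i]] => w; rewrite inE.
by apply: contraR => /negbTE ->; exact: eqxx.
Qed.
Definition tgen (i : I) := TensorAlg (finite_support_gen i).

End TensorAlgebra.

Section TensorProjection.
Variables (R : comPzRingType) (n : nat) (j : 'I_n).
Local Notation T := (tensor_alg R).

Lemma finite_support_proj (x : T 'I_n) :
  finite_support (fun w : seq 'I_n.-1 => x (map (lift j) w)).
Proof.
have [s xs] := tcoefP x; apply/asboolP.
exists [seq pmap (unlift j) u | u <- s] => w /xs ws.
apply/mapP; exists (map (lift j) w) => //.
by elim: w {ws} => //= k w <-; rewrite liftK.
Qed.

(* Killing y_j and renumbering the other generators: the coefficient of a word
   w in 'I_n.-1 is that of the word w renumbered through [lift j]. *)
Definition tensor_proj (x : T 'I_n) : T 'I_n.-1 :=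
  TensorAlg (finite_support_proj x).

Lemma tensor_projD : {morph tensor_proj : x y / x + y}.
Proof. by move=> x y; apply: tcoef_ext. Qed.

Lemma tensor_proj0 : tensor_proj 0 = 0.
Proof. exact: tcoef_ext. Qed.

Lemma tensor_projM : {morph tensor_proj : x y / x * y}.
Proof.
move=> x y; apply: tcoef_ext => w.
change (conv x y (map (lift j) w) = conv (tensor_proj x) (tensor_proj y) w).
rewrite /conv size_map.
by apply: eq_bigr => i _ /=; rewrite map_take map_drop.
Qed.

Lemma tensor_proj1 : tensor_proj 1 = 1.
Proof. by apply: tcoef_ext; case. Qed.

Lemma tensor_projZ : scalable tensor_proj.
Proof. by move=> a x; apply: tcoef_ext. Qed.

HB.instance Definition _ := GRing.isNmodMorphism.Build _ _ tensor_proj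
  (conj tensor_proj0 tensor_projD).
HB.instance Definition _ := GRing.isMonoidMorphism.Build _ _ tensor_proj
  (tensor_proj1, tensor_projM).
HB.instance Definition _ := GRing.isScalable.Build R _ _ *:%R tensor_proj
  tensor_projZ.

Lemma tensor_proj_gen i : tensor_proj (tgen R i) =
  if unlift j i is Some k then tgen R k else 0.
Proof.
apply: tcoef_ext => w /=; case: unliftP => [k ->|->] /=.
  congr (_ %:R); congr nat_of_bool.
  by rewrite -(inj_eq (inj_map (@lift_inj _ j))).
rewrite (_ : (_ == _) = false) //; apply/eqP; case: w => [|k w] //= [/eqP].
by rewrite eq_sym (negbTE (neq_lift _ _)).
Qed.

End TensorProjection.

Section QuotientTensor.
Variable R : comPzRingType.

Section Algebra.
Variable n : nat.

(* The monomials in which some generator occurs twice. *)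
Definition repeated_monomial (x : tensor_alg R 'I_n) : Prop :=
  exists2 w : seq 'I_n, ~~ uniq w & x = \prod_(i <- w) tgen R i.

Definition cohen_alg : Type := quotient_ring repeated_monomial.
HB.instance Definition _ := GRing.PzRing.on cohen_alg.

Definition cohen_alg_pi : tensor_alg R 'I_n -> cohen_alg :=
  qr_pi repeated_monomial.
HB.instance Definition _ := GRing.RMorphism.on cohen_alg_pi.

Definition cohen_alg_scale (a : R) (x : cohen_alg) : cohen_alg :=
  cohen_alg_pi (a *: repr x).

Lemma cohen_alg_scaleE a x :
  cohen_alg_scale a (cohen_alg_pi x) = cohen_alg_pi (a *: x).
Proof.
apply/qr_piP; rewrite -scalerBr -[_ - _]mul1r tensor_scalerAl.
exact/ideal_closureMl/qr_reprP.
Qed.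

Lemma cohen_alg_reprK (x : cohen_alg) : cohen_alg_pi (repr x) = x.
Proof. exact: qr_reprK. Qed.

Lemma cohen_alg_scaleA a b x :
  cohen_alg_scale a (cohen_alg_scale b x) = cohen_alg_scale (a * b) x.
Proof. by rewrite -[x]cohen_alg_reprK !cohen_alg_scaleE scalerA. Qed.

Lemma cohen_alg_scale1 : left_id 1 cohen_alg_scale.
Proof.
by move=> x; rewrite -[x]cohen_alg_reprK cohen_alg_scaleE scale1r.
Qed.

Lemma cohen_alg_scaleDr : right_distributive cohen_alg_scale +%R.
Proof.
move=> a x y; rewrite -[x]cohen_alg_reprK -[y]cohen_alg_reprK -rmorphD.
by rewrite !cohen_alg_scaleE scalerDr rmorphD.
Qed.

Lemma cohen_alg_scaleDl x : {morph cohen_alg_scale^~ x : a b / a + b}.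
Proof.
move=> a b; rewrite -[x]cohen_alg_reprK !cohen_alg_scaleE.
by rewrite scalerDl rmorphD.
Qed.

HB.instance Definition _ := GRing.Zmodule_isLmodule.Build R cohen_alg
  cohen_alg_scaleA cohen_alg_scale1 cohen_alg_scaleDr cohen_alg_scaleDl.

Lemma cohen_alg_piZ : scalable cohen_alg_pi.
Proof. by move=> a x; rewrite -cohen_alg_scaleE. Qed.
HB.instance Definition _ := GRing.isScalable.Build R _ _ *:%R cohen_alg_pi
  cohen_alg_piZ.

Lemma cohen_alg_scalerAl a (x y : cohen_alg) : a *: (x * y) = (a *: x) * y.
Proof.
rewrite -[x]cohen_alg_reprK -[y]cohen_alg_reprK -rmorphM -!linearZ -rmorphM.
by rewrite tensor_scalerAl.
Qed.

Lemma cohen_alg_scalerAr a (x y : cohen_alg) : a *: (x * y) = x * (a *: y).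
Proof.
rewrite -[x]cohen_alg_reprK -[y]cohen_alg_reprK -rmorphM -!linearZ -rmorphM.
by rewrite tensor_scalerAr.
Qed.

Definition cohen_alg_gen (i : 'I_n) : cohen_alg := cohen_alg_pi (tgen R i).

End Algebra.

Section Projection.
Variables (n : nat) (j : 'I_n).

Definition alg_proj_tensor (x : tensor_alg R 'I_n) : cohen_alg n.-1 :=
  cohen_alg_pi (tensor_proj j x).
HB.instance Definition _ := GRing.RMorphism.copy alg_proj_tensor
  (@cohen_alg_pi n.-1 \o tensor_proj j).

Lemma alg_proj_monomial x : repeated_monomial x -> alg_proj_tensor x = 0.
Proof.
case=> w w_rep ->; rewrite /alg_proj_tensor rmorph_prod /=.
have [jw|jw] := boolP (j \in w).
  have [u [v ->]] : exists u v, w = u ++ j :: v.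
    by case/splitPr: jw => u v; exists u, v.
  rewrite big_cat big_cons /= tensor_proj_gen unlift_none.
  by rewrite mul0r mulr0 rmorph0.
have wE : [seq lift j k | k <- pmap (unlift j) w] = w.
  elim: w jw {w_rep} => //= i w IHw; rewrite inE => /norP[ji jw].
  case: unliftP ji => [k E _|->] /=; last by rewrite eqxx.
  by rewrite IHw // -E.
rewrite -[X in \prod_(i <- X) _]wE big_map; apply/qr_piP; rewrite subr0.
apply: ideal_closure_gen; exists (pmap (unlift j) w).
  by apply: contra w_rep => w_uniq; rewrite -wE map_inj_uniq //; exact: lift_inj.
by apply: eq_bigr => k _; rewrite tensor_proj_gen liftK.
Qed.

Definition alg_proj : cohen_alg n -> cohen_alg n.-1 :=
  qr_lift alg_proj_monomial.
HB.instance Definition _ := GRing.RMorphism.on alg_proj.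

Lemma alg_proj_pi x : alg_proj (cohen_alg_pi x) = cohen_alg_pi (tensor_proj j x).
Proof. exact: qr_lift_pi. Qed.

Lemma alg_projZ : scalable alg_proj.
Proof.
move=> a x; rewrite -[x]cohen_alg_reprK -linearZ !alg_proj_pi.
by rewrite !linearZ.
Qed.
HB.instance Definition _ := GRing.isScalable.Build R _ _ *:%R alg_proj alg_projZ.

Lemma alg_proj_gen i : alg_proj (cohen_alg_gen i) =
  if unlift j i is Some k then cohen_alg_gen k else 0.
Proof.
by rewrite alg_proj_pi tensor_proj_gen; case: unlift.
Qed.

End Projection.

Lemma alg_proj_swap n (i i' : 'I_n) : exists j j' : 'I_n.+1,
  forall x, alg_proj i (alg_proj j x) = alg_proj i' (alg_proj j' x).
Proof.
have [j [j' jj']] := lift_swap i i'; exists j, j' => x.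
rewrite -[x]cohen_alg_reprK !alg_proj_pi; congr cohen_alg_pi.
apply: tcoef_ext => w /=; rewrite -!map_comp; congr (tcoef _ _).
exact: eq_map.
Qed.

Section Equalizer.
Variable n : nat.

Definition in_cohen_L : pred (cohen_alg n) :=
  fun x => `[< forall i j : 'I_n, alg_proj i x = alg_proj j x >].

Record cohen_L := CohenL {
  cohen_L_val :> cohen_alg n;
  _ : in_cohen_L cohen_L_val
}.
HB.instance Definition _ := [isSub for cohen_L_val].
HB.instance Definition _ := [Choice of cohen_L by <:].

Lemma in_cohen_L_subring : subring_closed in_cohen_L.
Proof.
split=> [|x y /asboolP xE /asboolP yE|x y /asboolP xE /asboolP yE];
  apply/asboolP => i j.
- by rewrite !rmorph1.
- by rewrite !rmorphB /= (xE i j) (yE i j).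
- by rewrite !rmorphM /= (xE i j) (yE i j).
Qed.
HB.instance Definition _ :=
  GRing.SubChoice_isSubPzRing.Build _ in_cohen_L cohen_L in_cohen_L_subring.

Lemma in_cohen_L_submod : subsemimod_closed in_cohen_L.
Proof.
split; first split.
- by apply/asboolP => i j; rewrite !rmorph0.
- move=> x y /asboolP xE /asboolP yE; apply/asboolP => i j.
  by rewrite !rmorphD /= (xE i j) (yE i j).
- move=> a x /asboolP xE; apply/asboolP => i j.
  by rewrite !linearZ /= (xE i j).
Qed.
HB.instance Definition _ :=
  GRing.SubZmodule_isSubLmodule.Build R _ in_cohen_L cohen_L in_cohen_L_submod.

Lemma cohen_L_scalerAl (a : R) (x y : cohen_L) : a *: (x * y) = (a *: x) * y.
Proof. by apply: val_inj; exact: cohen_alg_scalerAl. Qed.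

Lemma cohen_L_scalerAr (a : R) (x y : cohen_L) : a *: (x * y) = x * (a *: y).
Proof. by apply: val_inj; exact: cohen_alg_scalerAr. Qed.

End Equalizer.

Section Restriction.
Variable n : nat.

Lemma alg_proj_L (x : cohen_L n.+1) : in_cohen_L (alg_proj ord0 (val x)).
Proof.
have /asboolP xE := valP x; apply/asboolP => i i'.
have [j [j' jj']] := alg_proj_swap i i'.
by rewrite {1}(xE ord0 j) jj' (xE ord0 j').
Qed.

Definition alg_d (x : cohen_L n.+1) : cohen_L n := CohenL (alg_proj_L x).

Lemma alg_dE (j : 'I_n.+1) x : val (alg_d x) = alg_proj j (val x).
Proof. by have /asboolP xE := valP x; exact: xE. Qed.

Lemma alg_d0 : alg_d 0 = 0.
Proof. by apply: val_inj; exact: rmorph0. Qed.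

Lemma alg_dD : {morph alg_d : x y / x + y}.
Proof. by move=> x y; apply: val_inj; exact: rmorphD. Qed.

Lemma alg_d1 : alg_d 1 = 1.
Proof. by apply: val_inj; exact: rmorph1. Qed.

Lemma alg_dM : {morph alg_d : x y / x * y}.
Proof. by move=> x y; apply: val_inj; exact: rmorphM. Qed.

Lemma alg_dZ : scalable alg_d.
Proof.
by move=> a x; apply: val_inj; exact: (alg_projZ (ord0 : 'I_n.+1) a (val x)).
Qed.

HB.instance Definition _ := GRing.isNmodMorphism.Build _ _ alg_d
  (conj alg_d0 alg_dD).
HB.instance Definition _ := GRing.isMonoidMorphism.Build _ _ alg_d
  (alg_d1, alg_dM).
HB.instance Definition _ := GRing.isScalable.Build R _ _ *:%R alg_d alg_dZ.

End Restriction.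

Record cohen_L_lim := CohenLLim {
  cohen_L_lim_val :> forall n, cohen_L n;
  _ : `[< forall n, alg_d (cohen_L_lim_val n.+1) = cohen_L_lim_val n >]
}.
HB.instance Definition _ := [isSub for cohen_L_lim_val].
HB.instance Definition _ := [Choice of cohen_L_lim by <:].

Section LimitAlgebra.
Implicit Types (x y z : cohen_L_lim) (a b : R).

Lemma cohen_L_limP x n : alg_d (x n.+1) = x n.
Proof. by case: x => x /= /asboolP. Qed.

Lemma cohen_L_lim_ext x y : (forall n, x n = y n) -> x = y.
Proof. by move=> xy; apply: val_inj; apply: functional_extensionality_dep. Qed.

Let zero_proof : `[< forall n, alg_d (0 : cohen_L n.+1) = 0 :> cohen_L n >].
Proof. by apply/asboolP => n; exact: rmorph0. Qed.

Let one_proof : `[< forall n, alg_d (1 : cohen_L n.+1) = 1 :> cohen_L n >].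
Proof. by apply/asboolP => n; exact: rmorph1. Qed.

Let opp_proof x : `[< forall n, alg_d (- x n.+1) = - x n >].
Proof. by apply/asboolP => n; rewrite rmorphN /= cohen_L_limP. Qed.

Let add_proof x y : `[< forall n, alg_d (x n.+1 + y n.+1) = x n + y n >].
Proof. by apply/asboolP => n; rewrite rmorphD /= !cohen_L_limP. Qed.

Let mul_proof x y : `[< forall n, alg_d (x n.+1 * y n.+1) = x n * y n >].
Proof. by apply/asboolP => n; rewrite rmorphM /= !cohen_L_limP. Qed.

Let scale_proof a x : `[< forall n, alg_d (a *: x n.+1) = a *: x n >].
Proof. by apply/asboolP => n; rewrite linearZ /= cohen_L_limP. Qed.

Definition Llim_zero := @CohenLLim (fun n => 0) zero_proof.
Definition Llim_one := @CohenLLim (fun n => 1) one_proof.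
Definition Llim_opp x := @CohenLLim (fun n => - x n) (opp_proof x).
Definition Llim_add x y := @CohenLLim (fun n => x n + y n) (add_proof x y).
Definition Llim_mul x y := @CohenLLim (fun n => x n * y n) (mul_proof x y).
Definition Llim_scale a x := @CohenLLim (fun n => a *: x n) (scale_proof a x).

Lemma Llim_addA : associative Llim_add.
Proof. by move=> x y z; apply: cohen_L_lim_ext => n /=; rewrite addrA. Qed.

Lemma Llim_addC : commutative Llim_add.
Proof. by move=> x y; apply: cohen_L_lim_ext => n /=; rewrite addrC. Qed.

Lemma Llim_add0 : left_id Llim_zero Llim_add.
Proof. by move=> x; apply: cohen_L_lim_ext => n /=; rewrite add0r. Qed.

Lemma Llim_addN : left_inverse Llim_zero Llim_opp Llim_add.
Proof. by move=> x; apply: cohen_L_lim_ext => n /=; rewrite addNr. Qed.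

Lemma Llim_mulA : associative Llim_mul.
Proof. by move=> x y z; apply: cohen_L_lim_ext => n /=; rewrite mulrA. Qed.

Lemma Llim_mul1 : left_id Llim_one Llim_mul.
Proof. by move=> x; apply: cohen_L_lim_ext => n /=; rewrite mul1r. Qed.

Lemma Llim_mulr1 : right_id Llim_one Llim_mul.
Proof. by move=> x; apply: cohen_L_lim_ext => n /=; rewrite mulr1. Qed.

Lemma Llim_mulDl : left_distributive Llim_mul Llim_add.
Proof. by move=> x y z; apply: cohen_L_lim_ext => n /=; rewrite mulrDl. Qed.

Lemma Llim_mulDr : right_distributive Llim_mul Llim_add.
Proof. by move=> x y z; apply: cohen_L_lim_ext => n /=; rewrite mulrDr. Qed.

HB.instance Definition _ := GRing.isPzRing.Build cohen_L_lim
  Llim_addA Llim_addC Llim_add0 Llim_addN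
  Llim_mulA Llim_mul1 Llim_mulr1 Llim_mulDl Llim_mulDr.

Lemma Llim_scaleA a b x : Llim_scale a (Llim_scale b x) = Llim_scale (a * b) x.
Proof. by apply: cohen_L_lim_ext => n /=; rewrite scalerA. Qed.

Lemma Llim_scale1 : left_id 1 Llim_scale.
Proof. by move=> x; apply: cohen_L_lim_ext => n /=; rewrite scale1r. Qed.

Lemma Llim_scaleDr : right_distributive Llim_scale +%R.
Proof. by move=> a x y; apply: cohen_L_lim_ext => n /=; rewrite scalerDr. Qed.

Lemma Llim_scaleDl x : {morph Llim_scale^~ x : a b / a + b}.
Proof. by move=> a b; apply: cohen_L_lim_ext => n /=; rewrite scalerDl. Qed.

HB.instance Definition _ := GRing.Zmodule_isLmodule.Build R cohen_L_lim
  Llim_scaleA Llim_scale1 Llim_scaleDr Llim_scaleDl.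

Lemma Llim_scalerAl a x y : a *: (x * y) = (a *: x) * y.
Proof. by apply: cohen_L_lim_ext => n; exact: cohen_L_scalerAl. Qed.

Lemma Llim_scalerAr a x y : a *: (x * y) = x * (a *: y).
Proof. by apply: cohen_L_lim_ext => n; exact: cohen_L_scalerAr. Qed.

End LimitAlgebra.

End QuotientTensor.

Section UnitGroup.
Variable A : pzRingType.

Definition is_unit : pred A :=
  fun x => `[< exists y, x * y = 1 /\ y * x = 1 >].

Record unit_group := UnitGroup { unit_val :> A; _ : is_unit unit_val }.
HB.instance Definition _ := [isSub for unit_val].
HB.instance Definition _ := [Choice of unit_group by <:].
Implicit Types x y z : unit_group.

Lemma unit_inv_exists x : exists y : A, val x * y = 1 /\ y * val x = 1.
Proof. exact/asboolP/(valP x). Qed.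

Let inv x : A := sval (cid (unit_inv_exists x)).

Let invP x : val x * inv x = 1 /\ inv x * val x = 1.
Proof. exact: svalP (cid (unit_inv_exists x)). Qed.

Let one_proof : is_unit 1.
Proof. by apply/asboolP; exists 1; rewrite mulr1. Qed.

Let mul_proof x y : is_unit (val x * val y).
Proof.
have [xV Vx] := invP x; have [yV Vy] := invP y.
apply/asboolP; exists (inv y * inv x); split.
  by rewrite mulrA -(mulrA (val x)) yV mulr1.
by rewrite mulrA -(mulrA (inv y)) Vx mulr1.
Qed.

Let inv_proof x : is_unit (inv x).
Proof. by have [xV Vx] := invP x; apply/asboolP; exists (val x). Qed.

Definition unit_one := UnitGroup one_proof.
Definition unit_mul x y := UnitGroup (mul_proof x y).
Definition unit_inv x := UnitGroup (inv_proof x).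

Lemma unit_mulA : associative unit_mul.
Proof. by move=> x y z; apply: val_inj; exact: mulrA. Qed.

Lemma unit_mul1 : left_id unit_one unit_mul.
Proof. by move=> x; apply: val_inj; exact: mul1r. Qed.

Lemma unit_mulr1 : right_id unit_one unit_mul.
Proof. by move=> x; apply: val_inj; exact: mulr1. Qed.

Lemma unit_mulV : left_inverse unit_one unit_inv unit_mul.
Proof. by move=> x; apply: val_inj; have [] := invP x. Qed.

Lemma unit_mulVr : right_inverse unit_one unit_inv unit_mul.
Proof. by move=> x; apply: val_inj; have [] := invP x. Qed.

HB.instance Definition _ := isGroup.Build unit_group
  unit_mulA unit_mul1 unit_mulr1 unit_mulV unit_mulVr.

Lemma unit_valM x y : unit_val (x * y)%g = unit_val x * unit_val y.
Proof. by []. Qed.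

Lemma unit_val1 : unit_val 1%g = 1. Proof. by []. Qed.

End UnitGroup.

(* Main.v *)
From HB Require Import structures.
Require Import Defs.
From mathcomp Require Import all_boot all_algebra.
From mathcomp Require Import boolp.

(** The representation is the restriction of a Magnus map defined on the whole
    Cohen group, x_i^r |-> 1 + r y_i, with values in the units of
    A^R(y_1, .., y_n).  A monomial in which some y_i occurs twice vanishes.
    So y_i y_i = 0, and if some generator occurs in all terms of u and some
    generator occurs in all terms of v, then the commutator of 1 + u and 1 + v
    is 1 + (uv - vu).  Hence an iterated commutator of elements x_i^r goes to
    1 plus the product of the exponents times the Lie bracket of the y_i
    ([magnus_iter_commg]).  This depends on the exponents through their product
    only and is 1 when an index is repeated, so both families of relations are
    respected.

    The Magnus map is injective on the Cohen group ([magnus_inj]).  Fix a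
    generator x_j.  The left-normed commutators
    c(w, r) = [..[x_j^r, x_{w_1}], .., x_{w_k}] commute with each other
    ([lcomm_comm]), are additive in r ([lcommD]), and a conjugate of one of them
    by a power of a generator is a product of two of them ([lcommJ]).  So every
    word in the generators equals a h, where a is a product of elements c(w, r)
    and h is the word with every x_j deleted ([cohen_word_split]).  The image of
    a is 1 plus terms that contain y_j, while y_j does not occur in the image of
    h.  Hence if a h goes to 1, so does h ([magnus_split]).  By induction on
    the generators that occur, h = 1, and then a goes to 1.  When the indices
    j, w_1, .., w_k are distinct, the bracket of y_j, y_{w_1}, .., y_{w_k}
    contains exactly one monomial that starts with y_j, namely
    y_j y_{w_1} .. y_{w_k}; its coefficient in the image of a is therefore the
    sum of the exponents of the factors c(w, r) of a with this w.  These sums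
    vanish, and c(w, r) = 1 for the other w, so a = 1 ([magnus_lcomm_inj]).

    Killing x_j corresponds to killing y_j, so the Magnus map commutes with the
    projections ([magnus_proj]).  It follows that it maps the equalizer of the
    group projections into that of the algebra projections, and is compatible
    with the restrictions d_n; for infinite n one passes to the limit. *)

Set Implicit Arguments.
Unset Strict Implicit.
Unset Printing Implicit Defensive.

Import GRing.Theory.
Local Open Scope ring_scope.

(** * Coefficients in the tensor algebra *)

Section TensorCoefficients.
Variables (R : comPzRingType) (I : choiceType).
Implicit Types (x y : tensor_alg R I) (i j : I) (w v : seq I).

Lemma tensor_coef_sum (J : Type) (r : seq J) (F : J -> tensor_alg R I) w :
  (\sum_(k <- r) F k) w = \sum_(k <- r) F k w.
Proof. by elim/big_ind2: _ => // x1 a1 x2 a2 <- <-. Qed.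

(** The mirror image of [conv_cons]: splitting off the factorization of
    [rcons w c] whose second factor is empty. *)
Lemma conv_rcons (f g : seq I -> R) w c :
  conv f g (rcons w c) =
  conv f (fun u => g (rcons u c)) w + f (rcons w c) * g [::].
Proof.
elim: w f => [|d w IHw] f /=; first by rewrite conv_cons !conv_nil.
by rewrite !conv_cons IHw addrA.
Qed.

Lemma tensor_gen_mul_nil i x : (tgen R i * x) [::] = 0.
Proof. by rewrite tcoefM conv_nil mul0r. Qed.

Lemma tensor_gen_mul_cons i x c w :
  (tgen R i * x) (c :: w) = (c == i)%:R * x w.
Proof.
rewrite tcoefM conv_cons mul0r add0r -[x w in RHS]conv1 -convZl.
by apply: eq_convl => u /=; rewrite eqseq_cons -mulnb natrM.
Qed.

Lemma tensor_mul_gen_rcons i x c w :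
  (x * tgen R i) (rcons w c) = (c == i)%:R * x w.
Proof.
rewrite tcoefM conv_rcons mulr0 addr0 -[x w in RHS]convr1 -convZr.
apply: eq_bigr => k _; congr (_ * _).
by rewrite /= -[[:: i]]/(rcons [::] i) eqseq_rcons andbC -mulnb natrM.
Qed.

Lemma tensor_monomial_coef w v :
  (\prod_(i <- w) tgen R i) v = (v == w)%:R.
Proof.
elim: w v => [|i w IHw] v; first by rewrite big_nil.
rewrite big_cons; case: v => [|c v]; first exact: tensor_gen_mul_nil.
by rewrite tensor_gen_mul_cons IHw eqseq_cons -mulnb natrM.
Qed.

Lemma tensor_expand x (s : seq (seq I)) :
  uniq s -> (forall w, x w != 0 -> w \in s) ->
  x = \sum_(w <- s) x w *: \prod_(i <- w) tgen R i.
Proof.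
move=> s_uniq xs; apply: tcoef_ext => v; rewrite tensor_coef_sum.
under eq_bigr do rewrite tcoefZ tensor_monomial_coef.
have [vs|vs] := boolP (v \in s).
  rewrite (bigD1_seq v) //= eqxx mulr1 big1 ?addr0 // => w /negbTE.
  by rewrite eq_sym => ->; rewrite mulr0.
rewrite big1_seq ?(contraNeq (xs v) vs) // => w /= ws.
by case: eqP vs => [->|]; rewrite ?ws ?mulr0.
Qed.

Lemma tensor_mul_support x y w : (x * y) w != 0 ->
  exists u v, [/\ w = u ++ v, x u != 0 & y v != 0].
Proof.
move=> xy; have : [exists k : 'I_(size w).+1,
    (x (take k w) != 0) && (y (drop k w) != 0)].
  apply: contraNT xy => /existsPn xy0; rewrite tcoefM /conv big1 // => k _.
  have := xy0 k; rewrite negb_and !negbK.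
  by case/orP=> /eqP ->; rewrite ?mul0r ?mulr0.
case/existsP=> k /andP[xk yk]; exists (take k w), (drop k w).
by rewrite cat_take_drop.
Qed.

Definition involves i x := forall w, x w != 0 -> i \in w.
Definition avoids i x := forall w, x w != 0 -> i \notin w.

Lemma involvesMl i x y : involves i x -> involves i (x * y).
Proof.
by move=> xi w /tensor_mul_support[u [v [-> /xi xu _]]]; rewrite mem_cat xu.
Qed.

Lemma involvesZ i a x : involves i x -> involves i (a *: x).
Proof.
move=> xi w; rewrite tcoefZ => ax; apply: xi.
by apply: contraNneq ax => ->; rewrite mulr0.
Qed.

Lemma involves_sum i (J : Type) (r : seq J) (F : J -> tensor_alg R I) :
  (forall k, involves i (F k)) -> involves i (\sum_(k <- r) F k).
Proof.
move=> Fi w; apply: contraR => iw; rewrite tensor_coef_sum big1 // => k _.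
by apply/eqP; apply: contraR iw; exact: Fi.
Qed.

Lemma involves_gen i : involves i (tgen R i).
Proof.
move=> w /=; have [-> _|_] := eqVneq w [:: i]; first exact: mem_head.
by rewrite eqxx.
Qed.

Lemma avoidsM i x y : avoids i x -> avoids i y -> avoids i (x * y).
Proof.
move=> xi yi w /tensor_mul_support[u [v [-> /xi xu /yi yv]]].
by rewrite mem_cat negb_or xu.
Qed.

Lemma avoids_one_plus_gen i j a : i != j -> avoids i (1 + a *: tgen R j).
Proof.
move=> ij w; rewrite tcoefD tcoefZ tcoef1 /=.
have [-> //|_] := eqVneq w [::]; have [-> _|_] := eqVneq w [:: j].
  by rewrite inE.
by rewrite mulr0 addr0 eqxx.
Qed.

(** The left-normed Lie bracket of y_j, y_{w_1}, .., y_{w_k}. *)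
Definition lie_word j w : tensor_alg R I :=
  foldl (fun x i => x * tgen R i - tgen R i * x) (tgen R j) w.

Lemma lie_word_rcons j w i : lie_word j (rcons w i) =
  lie_word j w * tgen R i - tgen R i * lie_word j w.
Proof. by rewrite /lie_word foldl_rcons. Qed.

Lemma lie_word_support j w v : lie_word j w v != 0 -> perm_eq v (j :: w).
Proof.
elim/last_ind: w v => [|w i IHw] v.
  rewrite /=; case: (eqVneq v [:: j]) => [-> _|_]; first exact: perm_refl.
  by rewrite eqxx.
have genE u : tgen R i u != 0 -> u = [:: i].
  by rewrite /=; case: (eqVneq u [:: i]) => [//|_]; rewrite eqxx.
rewrite lie_word_rcons tcoefD tcoefN => vn0.
have [|] := boolP ((lie_word j w * tgen R i) v != 0).
  case/tensor_mul_support => u [u' [-> /IHw uw /genE ->]].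
  by rewrite -rcons_cons -cats1 perm_cat2r.
rewrite negbK => /eqP v0; move: vn0; rewrite v0 add0r oppr_eq0.
case/tensor_mul_support => u [u' [-> /genE -> /IHw uw]].
rewrite -rcons_cons perm_sym perm_rcons perm_sym /= perm_cons.
exact: uw.
Qed.

Lemma lie_word_involves j w : involves j (lie_word j w).
Proof. by move=> v /lie_word_support/perm_mem ->; exact: mem_head. Qed.

(** In the expansion of the bracket each further generator is put at the left or
    at the right end of the monomial.  As v does not contain j, the y_j in front
    is the initial one, and so all the others have been put at the right end. *)
Lemma lie_word_coef j w v :
  j \notin v -> lie_word j w (j :: v) = (v == w)%:R.
Proof.
elim/last_ind: w v => [|w i IHw] v jv.
  by rewrite /= eqseq_cons eqxx.
rewrite lie_word_rcons tcoefD tcoefN tensor_gen_mul_cons.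
have -> : (j == i)%:R * lie_word j w v = 0 :> R.
  apply/eqP; apply: contraNT jv => v0; apply: (@lie_word_involves j w).
  by apply: contraNneq v0 => ->; rewrite mulr0.
(* Only the term with y_i on the right is left; compare last letters. *)
rewrite subr0; case/lastP: v jv => [|v c] jv.
  rewrite -[[:: j]]/(rcons [::] j) tensor_mul_gen_rcons.
  have -> : lie_word j w [::] = 0.
    by apply/eqP; apply: contraT => /lie_word_involves.
  by rewrite mulr0; case: (w).
rewrite -rcons_cons tensor_mul_gen_rcons IHw.
  by rewrite eqseq_rcons andbC -mulnb natrM.
by apply: contra jv; rewrite mem_rcons inE => ->; rewrite orbT.
Qed.

End TensorCoefficients.

(** * Vanishing in the quotient algebra *)

Section CohenAlgebra.
Variables (R : comPzRingType) (n : nat).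
Implicit Types (x y : tensor_alg R 'I_n) (i j : 'I_n).

(** The elements with no coefficient on a repetition-free word form a two-sided
    ideal, because a factor of a repetition-free word is repetition-free; an
    element of it is a finite combination of repeated monomials. *)
Lemma cohen_alg_pi_eq0 x :
  cohen_alg_pi x = 0 <-> forall w, uniq w -> x w = 0.
Proof.
split=> [x0 w w_uniq|x0].
  have : ideal_closure (@repeated_monomial R n) x.
    by rewrite -[x]subr0; apply/qr_piP; rewrite -/(cohen_alg_pi x) x0.
  move=> xI; elim: xI w w_uniq => {x x0}.
  - move=> x [w' w'_rep ->] w w_uniq; rewrite tensor_monomial_coef.
    by case: eqP w'_rep => // <-; rewrite w_uniq.
  - by [].
  - by move=> x y _ x0 _ y0 w w_uniq; rewrite tcoefD x0 // y0 // addr0.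
  - move=> a x _ x0 w w_uniq; rewrite tcoefM /conv big1 // => k _.
    by rewrite x0 ?mulr0 // drop_uniq.
  - move=> a x _ x0 w w_uniq; rewrite tcoefM /conv big1 // => k _.
    by rewrite x0 ?mul0r // take_uniq.
have [s xs] := tcoefP x.
rewrite (@tensor_expand _ _ x (undup s)) ?undup_uniq //; last first.
  by move=> w /xs; rewrite mem_undup.
rewrite rmorph_sum big1 //= => w _; rewrite linearZ /=.
have [w_uniq|w_rep] := boolP (uniq w); first by rewrite x0 // scale0r.
rewrite [X in _ *: X](_ : _ = 0) ?scaler0 //.
apply/qr_piP; rewrite subr0; apply: ideal_closure_gen; exists w => //.
Qed.

Lemma cohen_alg_pi_eq x y :
  cohen_alg_pi x = cohen_alg_pi y <-> forall w, uniq w -> x w = y w.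
Proof.
split=> [xy w w_uniq|xy].
  apply/eqP; rewrite -subr_eq0 -tcoefN -tcoefD; apply/eqP.
  have: cohen_alg_pi (x - y) = 0 by rewrite rmorphB /= xy subrr.
  by move/cohen_alg_pi_eq0; apply.
apply/eqP; rewrite -subr_eq0 -rmorphB; apply/eqP/cohen_alg_pi_eq0 => w w_uniq.
by rewrite tcoefD tcoefN xy // subrr.
Qed.

(** Every monomial of the product contains y_i twice. *)
Lemma involves_mul0 i x y : involves i x -> involves i y ->
  cohen_alg_pi x * cohen_alg_pi y = 0.
Proof.
move=> xi yi; rewrite -rmorphM; apply/cohen_alg_pi_eq0 => w; apply: contraTeq.
case/tensor_mul_support => u [v [-> /xi iu /yi iv]].
by rewrite cat_uniq; apply/nandP; right; apply/nandP; left; rewrite negbK;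
   apply/hasP; exists i.
Qed.

Lemma involves_mulJ0 i x y : involves i x ->
  cohen_alg_pi x * cohen_alg_pi y * cohen_alg_pi x = 0.
Proof.
move=> xi; have <- : cohen_alg_pi (x * y) = cohen_alg_pi x * cohen_alg_pi y.
  exact: rmorphM.
exact: (involves_mul0 (involvesMl xi) xi).
Qed.

Lemma lie_word_rep0 j w : ~~ uniq (j :: w) -> cohen_alg_pi (lie_word R j w) = 0.
Proof.
move=> w_rep; apply/cohen_alg_pi_eq0 => v v_uniq; apply/eqP.
by apply: contraNT w_rep => /lie_word_support/perm_uniq <-.
Qed.

End CohenAlgebra.

(** * The Magnus map on the Cohen group *)

(** With c = uv - vu, the assumptions give uc = vc = 0, so that
    (1 + v)(1 + u)(1 + c) = (1 + u)(1 + v); it remains to cancel the unit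
    (1 + v)(1 + u). *)
Lemma unit_commg (A : pzRingType) (x y : unit_group A) (u v : A) :
  unit_val x = 1 + u -> unit_val y = 1 + v ->
  u * u = 0 -> v * v = 0 -> u * v * u = 0 -> v * u * v = 0 ->
  unit_val [~ x, y]%g = 1 + (u * v - v * u).
Proof.
move=> xE yE uu vv uvu vuv.
have unitI (z : unit_group A) : injective ( *%R (unit_val z)).
  by apply: (@can_inj _ _ _ ( *%R (unit_val z^-1%g))) => a;
     rewrite mulrA -unit_valM mulVg unit_val1 mul1r.
apply: (@unitI (y * x)%g); rewrite -unit_valM -commgC !unit_valM xE yE.
set c := u * v - v * u.
have uc : u * c = 0 by rewrite mulrBr !mulrA uu mul0r uvu subr0.
have vc : v * c = 0 by rewrite mulrBr !mulrA vv mul0r vuv subr0.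
have cE : c + v * u = u * v by rewrite subrK.
clearbody c; rewrite -[RHS]mulrA mulrDl mul1r [(1 + u) * (1 + c)]mulrDl mul1r.
rewrite (mulrDr u 1 c) uc mulr1 addr0 mulrDl mul1r !mulrDr !mulr1 vc addr0.
by rewrite [1 + c + u]addrAC [RHS]addrACA cE addrA [1 + u + v]addrAC.
Qed.

Lemma iter_commg_rcons (G : groupType) (x : G) s y :
  iter_commg (rcons (x :: s) y) = [~ iter_commg (x :: s), y]%g.
Proof. by rewrite /= foldl_rcons. Qed.

Section Magnus.
Variables (R : comPzRingType) (n : nat).
Implicit Types (i j : 'I_n) (r s : R) (g h : cohen_group R n).
Local Notation pi := (@cohen_alg_pi R n).

Lemma pi_one_plus_genD i r s :
  pi (1 + r *: tgen R i) * pi (1 + s *: tgen R i) =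
  pi (1 + (r + s) *: tgen R i).
Proof.
have sq0 : pi (r *: tgen R i) * pi (s *: tgen R i) = 0.
  by apply: (involves_mul0 (i := i)); apply/involvesZ/involves_gen.
rewrite !rmorphD !rmorph1 /= mulrDl !mulrDr sq0 !mul1r mulr1 addr0.
by rewrite scalerDl rmorphD /= -addrA [pi (s *: _) + _]addrC.
Qed.

Lemma magnus_gen_unit i r : is_unit (pi (1 + r *: tgen R i)).
Proof.
apply/asboolP; exists (pi (1 + (- r) *: tgen R i)).
by rewrite !pi_one_plus_genD subrr addNr scale0r addr0 rmorph1.
Qed.

Definition magnus_gen i r := UnitGroup (magnus_gen_unit i r).

Lemma magnus_genD i r s :
  magnus_gen i (r + s) = (magnus_gen i r * magnus_gen i s)%g.
Proof. by apply: val_inj; rewrite /= pi_one_plus_genD. Qed.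

Definition magnus_free := fp_lift magnus_genD.
HB.instance Definition _ := UMagmaMorphism.on magnus_free.

(** By induction on the length: the bracket u reached so far involves y_{p.1}
    in every term and the next factor v = r y_i involves y_i, so the products
    uu, vv, uvu and vuv vanish and [unit_commg] applies. *)
Lemma magnus_iter_commg (p : 'I_n * R) (s : seq ('I_n * R)) :
  unit_val (iter_commg [seq magnus_gen q.1 q.2 | q <- p :: s]) =
  pi (1 + (\prod_(q <- p :: s) q.2) *: lie_word R p.1 (unzip1 s)).
Proof.
elim/last_ind: s => [|s [i r] IHs].
  by rewrite /= big_seq1.
rewrite -rcons_cons map_rcons iter_commg_rcons /unzip1 map_rcons.
rewrite lie_word_rcons -/(unzip1 s) -cats1 big_cat big_seq1.
rewrite [(i, r).1]/= [(i, r).2]/=.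
set a := \prod_(q <- _) _ in IHs *; set x := lie_word _ _ _ in IHs *.
have xj : involves p.1 (a *: x) by exact/involvesZ/lie_word_involves.
have yi : involves i (r *: tgen R i) by exact/involvesZ/involves_gen.
rewrite (unit_commg (u := pi (a *: x)) (v := pi (r *: tgen R i))).
- rewrite -!(rmorphM pi) -(rmorphB pi) -(rmorph1 pi) -(rmorphD pi); congr pi.
  rewrite -!tensor_scalerAl -!tensor_scalerAr !scalerA [r * a]mulrC.
  by rewrite -scalerBr.
- by rewrite IHs rmorphD rmorph1.
- by rewrite -(rmorph1 pi) -rmorphD.
- exact: (involves_mul0 xj xj).
- exact: (involves_mul0 yi yi).
- exact: (involves_mulJ0 _ xj).
- exact: (involves_mulJ0 _ yi).
Qed.

Lemma magnus_free_commg (s : seq ('I_n * R)) :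
  magnus_free (iter_commg (free_word s)) =
  iter_commg [seq magnus_gen q.1 q.2 | q <- s].
Proof.
rewrite iter_commg_morph -map_comp; congr iter_commg.
by apply: eq_map => q /=; rewrite /magnus_free fp_lift_gen.
Qed.

Lemma magnus_relator x : cohen_relator x -> magnus_free x = 1%g.
Proof.
case=> {x} [[|p s] // s_rep|s t st1 st2].
  rewrite magnus_free_commg; apply: val_inj.
  apply: etrans (magnus_iter_commg p s) _.
  by rewrite (rmorphD pi) /= linearZ /= lie_word_rep0 // scaler0 addr0.
rewrite (_ : magnus_free _ = magnus_free (iter_commg (free_word s))
    / magnus_free (iter_commg (free_word t)))%g; last exact: gmulfF.
rewrite (_ : magnus_free (iter_commg (free_word s)) =
             magnus_free (iter_commg (free_word t))) ?mulgV //.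
rewrite !magnus_free_commg; case: s t st1 st2 => [|p s] [|q t] //.
case=> pq st st2; apply: val_inj.
apply: etrans (magnus_iter_commg p s) _.
apply: etrans (esym (magnus_iter_commg q t)).
by rewrite st2 pq st.
Qed.

Definition magnus : cohen_group R n -> unit_group (cohen_alg R n) :=
  qg_lift magnus_relator.
HB.instance Definition _ := UMagmaMorphism.on magnus.

Lemma magnus_cohen_gen i r : magnus (cohen_gen i r) = magnus_gen i r.
Proof. exact: etrans (qg_lift_pi _ _) (fp_lift_gen _ _ _). Qed.

End Magnus.

(** * The normal closure of one generator *)

Lemma cohen_genN (R : comPzRingType) n (i : 'I_n) (r : R) :
  cohen_gen i (- r) = (cohen_gen i r)^-1%g.
Proof.
apply/esym/mulg1_eq; rewrite -cohen_genD subrr.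
by apply: (@mulgI _ (cohen_gen i 0)); rewrite -cohen_genD addr0 mulg1.
Qed.

Section NormalClosure.
Variables (R : comPzRingType) (n : nat) (j : 'I_n).
Implicit Types (i : 'I_n) (r : R) (g h : cohen_group R n).
Implicit Types (w v : seq 'I_n) (l : seq (seq 'I_n * R)).

(** The commutator c(w, r) = [..[x_j^r, x_{w_1}], .., x_{w_k}].  A relation of
    the second kind moves all exponents onto x_j, so no other exponents are
    needed to generate the normal closure of x_j. *)
Definition lcomm w r : cohen_group R n :=
  iter_commg [seq cohen_gen p.1 p.2 | p <- (j, r) :: [seq (i, 1) | i <- w]].

Lemma lcomm_nil r : lcomm [::] r = cohen_gen j r.
Proof. by []. Qed.

Lemma lcomm_rep1 w r : ~~ uniq (j :: w) -> lcomm w r = 1%g.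
Proof.
move=> w_rep; apply: cohen_rep.
by rewrite /= /unzip1 -map_comp map_id.
Qed.

Lemma lcomm_gen w r i s :
  [~ lcomm w r, cohen_gen i s]%g = lcomm (rcons w i) (r * s).
Proof.
rewrite -[cohen_gen i s]/(cohen_gen (i, s).1 (i, s).2) -iter_commg_rcons.
rewrite -(map_rcons (fun p : 'I_n * R => cohen_gen p.1 p.2) (_ :: _) (i, s)).
apply: cohen_prod.
  by rewrite /= /unzip1 !map_rcons -!map_comp.
rewrite -cats1 big_cat big_seq1 !big_cons !big_map /=.
by rewrite !(big1_eq _ (fun=> true)) // !mulr1.
Qed.

Lemma lcommJ w r i s : (lcomm w r ^ cohen_gen i s =
  lcomm w r * lcomm (rcons w i) (r * s))%g.
Proof. by rewrite -lcomm_gen commgEl mulVKg. Qed.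

(** A further commutator with x_j repeats an index, so each c(w, r) commutes
    with x_j^s.  For longer v, the element c(v i, s) is c(v, s)^-1 times its
    conjugate by x_i; c(w, r) commutes with that conjugate because the conjugate
    of c(w, r) by x_i^-1 is again a product of such commutators, which commute
    with c(v, s) by induction. *)
Lemma lcomm_comm w v r s : commute (lcomm w r) (lcomm v s).
Proof.
elim/last_ind: v w r s => [|v i IHv] w r s.
  apply/commgP/eqP; rewrite lcomm_nil lcomm_gen; apply: lcomm_rep1.
  by rewrite /= mem_rcons mem_head.
have -> : lcomm (rcons v i) s = ((lcomm v s)^-1 * lcomm v s ^ cohen_gen i 1)%g.
  by rewrite lcommJ mulr1 mulKg.
apply: commuteM; first exact/commuteV/IHv.
rewrite -[lcomm w r](conjgKV (cohen_gen i 1)) -cohen_genN.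
rewrite /commute -!conjMg; congr (_ ^ _)%g.
rewrite lcommJ; apply/commute_sym/commuteM; exact/commute_sym/IHv.
Qed.

(** By induction on w: as the c(w, -) commute, taking the commutator with x_i is
    multiplicative on the subgroup they generate. *)
Lemma lcommD w r s : lcomm w (r + s) = (lcomm w r * lcomm w s)%g.
Proof.
elim/last_ind: w r s => [|w i IHw] r s; first by rewrite !lcomm_nil cohen_genD.
rewrite -[in LHS](mulr1 (r + s)).
rewrite -[in lcomm _ r](mulr1 r) -[in lcomm _ s](mulr1 s).
rewrite -lcomm_gen IHw commgEl conjMg !lcommJ !mulr1.
set a := lcomm w r; set b := lcomm w s; set a' := lcomm _ r.
set b' := lcomm _ s; have -> : (a * a' * (b * b') = a * b * (a' * b'))%g.
  by rewrite -!mulgA; congr (_ * _)%g; rewrite !mulgA [(a' * b)%g]lcomm_comm.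
by rewrite mulKg.
Qed.

Lemma lcomm0 w : lcomm w 0 = 1%g.
Proof. by apply: (@mulgI _ (lcomm w 0)); rewrite -lcommD addr0 mulg1. Qed.

Definition lcomm_prod l := (\prod_(q <- l) lcomm q.1 q.2)%g.

Lemma lcomm_prodJ l i r :
  exists l', (lcomm_prod l ^ cohen_gen i r)%g = lcomm_prod l'.
Proof.
exists (flatten [seq [:: q; (rcons q.1 i, q.2 * r)] | q <- l]).
elim: l => [|q l IHl] /=; first by rewrite /lcomm_prod big_nil conj1g.
rewrite /lcomm_prod !big_cons conjMg IHl lcommJ -mulgA //.
Qed.

(** As the factors commute, those with the word v can be collected in front and
    merged by additivity of c(v, -). *)
Lemma lcomm_prod_split v l : lcomm_prod l =
  (lcomm v (\sum_(q <- l | q.1 == v) q.2) *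
   lcomm_prod [seq q <- l | q.1 != v])%g.
Proof.
rewrite /lcomm_prod; elim: l => [|q l IHl] /=.
  by rewrite !big_nil lcomm0 mulg1.
rewrite !big_cons IHl; have [<-|_] /= := eqVneq q.1 v.
  by rewrite lcommD mulgA.
rewrite big_cons !mulgA; congr (_ * _)%g; exact: lcomm_comm.
Qed.

(** Collect the factors word by word: c(v, -) is trivial if j :: v has a
    repetition, and otherwise its total exponent is zero. *)
Lemma lcomm_prod_eq1 l :
  (forall v, uniq (j :: v) -> \sum_(q <- l | q.1 == v) q.2 = 0) ->
  lcomm_prod l = 1%g.
Proof.
have [m] := ubnP (size l); elim: m l => // m IHm [|q l] le_lm l0.
  by rewrite /lcomm_prod big_nil.
rewrite (lcomm_prod_split q.1).
have -> : lcomm q.1 (\sum_(p <- q :: l | p.1 == q.1) p.2) = 1%g.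
  have [/l0 ->|] := boolP (uniq (j :: q.1)); first exact: lcomm0.
  exact: lcomm_rep1.
rewrite mul1g; apply: IHm => [|v /l0 v0].
  rewrite /= eqxx /= size_filter; move: le_lm; rewrite /= ltnS.
  exact: leq_ltn_trans (count_size _ _).
rewrite big_filter_cond; have [vq|vq] := eqVneq v q.1.
  by rewrite big1 // => p; rewrite vq => /andP[/negbTE->].
rewrite -[RHS]v0; apply: eq_bigl => p.
by case: (eqVneq p.1 v) => [->|_]; rewrite ?vq ?andbF.
Qed.

(** Each factor is 1 plus terms that contain y_j, and products of two such
    terms vanish, so the product of the factors becomes a sum. *)
Lemma magnus_lcomm_prod l : unit_val (magnus (lcomm_prod l)) =
  cohen_alg_pi (1 + \sum_(q <- l) q.2 *: lie_word R j q.1).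
Proof.
have lieM (q : seq 'I_n * R) : involves j (q.2 *: lie_word R j q.1).
  exact/involvesZ/lie_word_involves.
rewrite /lcomm_prod; elim: l => [|q l IHl].
  by rewrite !big_nil addr0 gmulf1.
rewrite !big_cons gmulfM unit_valM IHl.
have -> : unit_val (magnus (lcomm q.1 q.2)) =
    cohen_alg_pi (1 + q.2 *: lie_word R j q.1).
  rewrite /lcomm iter_commg_morph -map_comp.
  rewrite (eq_map (g := fun p => magnus_gen p.1 p.2)); last first.
    by move=> p /=; exact: magnus_cohen_gen.
  apply: etrans (magnus_iter_commg _ _) _.
  rewrite big_cons big_map (big1_eq _ (fun=> true)) //= mulr1.
  by rewrite /unzip1 -map_comp map_id.
rewrite !(rmorphD (@cohen_alg_pi R n)) (rmorph1 (@cohen_alg_pi R n)).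
rewrite mulrDl mul1r mulrDr mulr1 (involves_mul0 (lieM q)) ?addr0.
  by rewrite -addrA [X in _ + X]addrC.
exact: involves_sum.
Qed.

End NormalClosure.

(** * Faithfulness on the Cohen group *)

Section Faithful.
Variables (R : comPzRingType) (n : nat).
Implicit Types (i j : 'I_n) (l : seq (seq 'I_n * R)) (u : seq ('I_n * R)).
Implicit Types g h : cohen_group R n.
Local Notation pi := (@cohen_alg_pi R n).

Definition cohen_word u : cohen_group R n :=
  (\prod_(p <- u) cohen_gen p.1 p.2)%g.

Lemma cohen_word_surj g : exists u, g = cohen_word u.
Proof.
exists (repr (repr g)); rewrite -[LHS]qg_reprK -[repr g in LHS]fp_of_wordK.
by rewrite fp_of_wordE gmulf_prod.
Qed.

Lemma magnus_word u : unit_val (magnus (cohen_word u)) =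
  pi (\prod_(p <- u) (1 + p.2 *: tgen R p.1)).
Proof.
rewrite /cohen_word; elim: u => [|p u IHu]; first by rewrite !big_nil gmulf1.
rewrite !big_cons gmulfM unit_valM IHu (rmorphM pi); congr (_ * _).
exact: (congr1 (@unit_val _) (magnus_cohen_gen p.1 p.2)).
Qed.

(** A letter other than x_j is moved to the right past the factor in the normal
    closure of x_j, at the price of conjugating that factor. *)
Lemma cohen_word_split j u : exists l, cohen_word u =
  (lcomm_prod j l * cohen_word [seq p <- u | p.1 != j])%g.
Proof.
rewrite /cohen_word; elim: u => [|p u [l IHu]] /=.
  by exists [::]; rewrite /lcomm_prod !big_nil mulg1.
rewrite big_cons IHu; have [->|_] /= := eqVneq p.1 j.
  by exists (([::], p.2) :: l); rewrite /lcomm_prod big_cons /= mulgA.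
have [l' l'E] := lcomm_prodJ j l p.1 (- p.2).
by exists l'; rewrite big_cons -l'E cohen_genN !mulgA -conjgCV.
Qed.

(** On a word that avoids j the coefficient of the product is that of the second
    factor, since the first one is 1 plus terms that contain y_j. *)
Lemma magnus_split j l u : j \notin unzip1 u ->
  magnus (lcomm_prod j l * cohen_word u)%g = 1%g ->
  magnus (cohen_word u) = 1%g.
Proof.
move=> ju /(congr1 (@unit_val _)); rewrite gmulfM unit_valM.
rewrite magnus_lcomm_prod magnus_word unit_val1 => /esym.
set x := \sum_(q <- l) _; set y := \prod_(p <- u) _ => xy1.
have xj : involves j x.
  by apply: involves_sum => q; exact/involvesZ/lie_word_involves.
have yj : avoids j y.
  rewrite /y; elim: u ju {y xy1} => [_|p u IHu].
    by rewrite big_nil => -[|c w] //=; rewrite eqxx.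
  rewrite /= inE negb_or big_cons => /andP[jp /IHu]; apply: avoidsM.
  exact: avoids_one_plus_gen.
apply: val_inj; apply: etrans (magnus_word u) _; rewrite -/y.
apply/(@cohen_alg_pi_eq R n y 1) => w w_uniq.
have [jw|jw] := boolP (j \in w).
  have -> : y w = 0 by apply/eqP; apply: contraTT jw; exact: yj.
  by rewrite tcoef1; case: eqP jw => [->|].
have : pi ((1 + x) * y) = pi 1 by rewrite (rmorphM pi) -xy1.
move/cohen_alg_pi_eq => /(_ w w_uniq) <-; rewrite mulrDl mul1r tcoefD.
have -> : (x * y) w = 0 by apply/eqP; apply: contraNT jw; exact: involvesMl.
by rewrite addr0.
Qed.

(** The coefficient at y_j y_v of the image is the total exponent of c(v, -). *)
Lemma magnus_lcomm_inj j l :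
  magnus (lcomm_prod j l) = 1%g -> lcomm_prod j l = 1%g.
Proof.
move=> /(congr1 (@unit_val _)); rewrite magnus_lcomm_prod unit_val1 => l1.
apply: lcomm_prod_eq1 => v jv_uniq.
have : pi (1 + \sum_(q <- l) q.2 *: lie_word R j q.1) = pi 1 by rewrite l1.
move/cohen_alg_pi_eq => /(_ _ jv_uniq).
have /andP[jv _] := jv_uniq.
rewrite tcoefD tensor_coef_sum tcoef1 add0r; apply: etrans.
rewrite big_mkcond; apply: eq_bigr => q _.
rewrite tcoefZ lie_word_coef // [v == _]eq_sym.
by case: eqP; rewrite ?mulr1 ?mulr0.
Qed.

(** By induction on the list js of generators allowed to occur, splitting off
    the normal closure of the first of them. *)
Lemma magnus_word_eq1 (js : seq 'I_n) u : {subset unzip1 u <= js} ->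
  magnus (cohen_word u) = 1%g -> cohen_word u = 1%g.
Proof.
elim: js u => [|j js IHjs] u u_js.
  case: u u_js => [|p u] u_js; first by rewrite /cohen_word big_nil.
  by have := u_js _ (mem_head _ _).
have [l ->] := cohen_word_split j u; set u' := filter _ _ => lu1.
have ju' : j \notin unzip1 u'.
  by apply/mapP => -[p]; rewrite mem_filter => /andP[/eqP pj _] /esym.
have u'1 := magnus_split ju' lu1.
have u'E : cohen_word u' = 1%g.
  apply: IHjs u'1 => _ /mapP[p + ->]; rewrite mem_filter => /andP[pj pu].
  by have := u_js _ (map_f _ pu); rewrite inE (negbTE pj).
by move: lu1; rewrite u'E mulg1; exact: magnus_lcomm_inj.
Qed.

Lemma magnus_inj : injective (@magnus R n).
Proof.
apply: gmulf_inj => g; have [u ->] := cohen_word_surj g.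
exact: (@magnus_word_eq1 (unzip1 u)).
Qed.

End Faithful.

(** * Equalizers and limits *)

Section Restriction.
Variable R : comPzRingType.

(** Both sides are multiplicative in g and send x_j^r to 1 and any
    other x_i^r to 1 + r y_k, where k is the number of x_i after the removal of
    x_j. *)
Lemma magnus_proj n (j : 'I_n) (g : cohen_group R n) :
  alg_proj j (unit_val (magnus g)) = unit_val (magnus (cohen_proj j g)).
Proof.
have [u ->] := cohen_word_surj g; rewrite /cohen_word.
elim: u => [|p u IHu]; first by rewrite big_nil !gmulf1 !unit_val1 rmorph1.
rewrite big_cons !gmulfM !unit_valM rmorphM /= IHu; congr (_ * _).
have genE : tensor_proj j (1 + p.2 *: tgen R p.1) =
    1 + p.2 *: (if unlift j p.1 is Some k then tgen R k else 0).
  by rewrite rmorphD rmorph1 /= linearZ /= tensor_proj_gen.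
rewrite magnus_cohen_gen cohen_projE /cohen_proj_gen.
apply: etrans (alg_proj_pi _ _) _; rewrite genE; case: unlift => [k|].
  by rewrite magnus_cohen_gen.
by rewrite scaler0 addr0 gmulf1 unit_val1 rmorph1.
Qed.

Lemma magnus_in_L n (g : cohen_H R n) : in_cohen_L (unit_val (magnus (val g))).
Proof.
have /asboolP gE := valP g; apply/asboolP => i j.
by rewrite !magnus_proj (gE i j).
Qed.

Definition magnus_H n (g : cohen_H R n) : cohen_L R n := CohenL (magnus_in_L g).

Lemma magnus_HM n (g h : cohen_H R n) :
  magnus_H (g * h)%g = magnus_H g * magnus_H h.
Proof. by apply: val_inj; rewrite /= gmulfM. Qed.

Lemma magnus_H1 n : magnus_H (1 : cohen_H R n)%g = 1.
Proof. by apply: val_inj; rewrite /= gmulf1. Qed.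

Lemma magnus_H_inj n : injective (@magnus_H n).
Proof.
by move=> g h /(congr1 val) gh; apply/val_inj/magnus_inj/val_inj.
Qed.

Lemma magnus_H_d n (g : cohen_H R n.+1) :
  alg_d (magnus_H g) = magnus_H (cohen_d g).
Proof. by apply: val_inj; exact: (magnus_proj ord0 (val g)). Qed.

Section UnitLift.
Variables (G : groupType) (A : pzRingType) (f : G -> A).
Hypotheses (f1 : f 1%g = 1) (fM : forall x y, f (x * y)%g = f x * f y).

Lemma unit_lift_proof x : is_unit (f x).
Proof. by apply/asboolP; exists (f x^-1%g); rewrite -!fM mulgV mulVg. Qed.

(** A multiplicative map from a group that preserves 1 takes values in units,
    the inverse of f x being f x^-1. *)
Lemma injective_unit_lift : injective f ->
  exists e : {multiplicative G -> unit_group A}, injective e.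
Proof.
move=> f_inj; pose e x := UnitGroup (unit_lift_proof x).
have eM : {morph e : x y / (x * y)%g}.
  by move=> x y; apply: val_inj; exact: fM.
pose eH := isMultiplicative.Build G (unit_group A) e eM.
pose E : {multiplicative G -> unit_group A} := HB.pack e eH.
by exists E => x y /(congr1 val); exact: f_inj.
Qed.

End UnitLift.

Lemma magnus_lim_proof (g : cohen_H_lim R) :
  `[< forall n, alg_d (magnus_H (g n.+1)) = magnus_H (g n) >].
Proof. by apply/asboolP => n; rewrite magnus_H_d cohen_H_limP. Qed.

Definition magnus_lim (g : cohen_H_lim R) : cohen_L_lim R :=
  CohenLLim (magnus_lim_proof g).

End Restriction.

Theorem corollary4p10 (R : comPzRingType) :
  (forall n : nat, (1 <= n)%N ->
     exists e : {multiplicative cohen_H R n -> unit_group (cohen_L R n)},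
       injective e) /\
  (exists e : {multiplicative cohen_H_lim R -> unit_group (cohen_L_lim R)},
     injective e).
Proof.
split=> [n _|].
  apply: injective_unit_lift (@magnus_H_inj R n).
    exact: magnus_H1.
  exact: magnus_HM.
apply: (@injective_unit_lift _ _ (@magnus_lim R)).
- by apply: cohen_L_lim_ext => n; exact: magnus_H1.
- by move=> g h; apply: cohen_L_lim_ext => n; exact: magnus_HM.
- move=> g h /(congr1 (fun x : cohen_L_lim R => cohen_L_lim_val x)) gh.
  apply: cohen_H_lim_ext => n; apply: magnus_H_inj.
  exact: (congr1 (fun x : forall n, cohen_L R n => x n) gh).
Qed.
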